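(* Let $G$ be a virtually free pro-$p$ group. Then $G$ is either virtually procyclic or randomly free.
   Context: A pro-$p$ group is virtually free pro-$p$ if it has an open subgroup which is a free pro-$p$ group. For a profinite group $G$ with normalised Haar measure, a non-trivial word $w\in F_r$ is a probabilistic identity on $G$ if the set of $(g_1,\ldots,g_r)\in G^r$ with $w(g_1,\ldots,g_r)=1$ has positive Haar measure in $G^r$; $G$ is randomly free if it has no probabilistic identity. *)

(* Defs.v *)
From HB Require Import structures.
From mathcomp Require Import all_boot all_order all_algebra.
From mathcomp Require Import all_classical all_reals all_analysis.
Set Implicit Arguments. Unset Strict Implicit. Unset Printing Implicit Defensive.
Import Order.TTheory GRing.Theory Num.Theory.
Local Open Scope classical_set_scope.

Record ProfGroup := {
  pg_T :> ptopologicalType;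
  pg_mul : pg_T -> pg_T -> pg_T;
  pg_inv : pg_T -> pg_T;
  pg_one : pg_T;
  pg_mulA : forall x y z, pg_mul x (pg_mul y z) = pg_mul (pg_mul x y) z;
  pg_mul1g : forall x, pg_mul pg_one x = x;
  pg_mulVg : forall x, pg_mul (pg_inv x) x = pg_one;
  pg_mul_cont : continuous (fun xy : pg_T * pg_T => pg_mul xy.1 xy.2);
  pg_inv_cont : continuous pg_inv;
  pg_compact : compact [set: pg_T];
  pg_hausdorff : hausdorff_space pg_T;
  pg_totdisc : totally_disconnected [set: pg_T] }.

Section Defs.
Variable G : ProfGroup.
Local Notation "x * y" := (pg_mul x y) : classical_set_scope.
Local Notation "x ^-1" := (pg_inv x) : classical_set_scope.
Local Notation "1" := (pg_one G) : classical_set_scope.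

Definition is_subgroup (H : set G) :=
  [/\ H 1, (forall x y, H x -> H y -> H (x * y)) & (forall x, H x -> H (x^-1))].

Definition is_normal (N : set G) :=
  is_subgroup N /\ forall g n, N n -> N (g^-1 * (n * g)).

Definition open_subgroup (H : set G) := is_subgroup H /\ open H.

(* the (finite) index of the subgroup N is p^k: a list of p^k left-coset
   representatives, covering G, with pairwise distinct cosets *)
Definition index_pow (N : set G) (p : nat) :=
  exists (k : nat) (s : seq G),
    [/\ size s = (p ^ k)%N,
        (forall g, exists2 i, (i < size s)%N & exists2 n, N n & g = nth 1 s i * n)
      & (forall i j, (i < size s)%N -> (j < size s)%N ->
           N ((nth 1 s i)^-1 * nth 1 s j) -> i = j)].

Definition is_pro_p (p : nat) :=
  prime p /\ forall N : set G, is_normal N -> open N -> index_pow N p.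

Definition conv_to_one (X : Type) (f : X -> G) :=
  forall U : set G, open U -> U 1 -> finite_set [set x | ~ U (f x)].

Definition gpowz (g : G) (n : int) : G :=
  match n with
  | Posz k => iter k (pg_mul g) 1
  | Negz k => (iter k.+1 (pg_mul g) 1)^-1
  end.

Definition procyclic_subgroup (H : set G) :=
  is_subgroup H /\ exists2 g, H g & closure [set gpowz g n | n in [set: int]] = H.

Definition virtually_procyclic :=
  exists H : set G, open_subgroup H /\ procyclic_subgroup H.

End Defs.

Definition is_hom_on (G K : ProfGroup) (H : set G) (phi : G -> K) :=
  forall x y, H x -> H y -> phi (pg_mul x y) = pg_mul (phi x) (phi y).

Definition free_pro_p_subgroup (p : nat) (G : ProfGroup) (H : set G) :=
  is_subgroup H /\
  exists (X : Type) (iota : X -> G),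
    [/\ forall x, H (iota x), conv_to_one iota &
      forall K : ProfGroup, is_pro_p K p -> forall f : X -> K, conv_to_one f ->
        exists phi : G -> K,
          [/\ is_hom_on H phi, {within H, continuous phi},
              (forall x, phi (iota x) = f x) &
              forall psi : G -> K, is_hom_on H psi -> {within H, continuous psi} ->
                (forall x, psi (iota x) = f x) -> forall h, H h -> psi h = phi h]].

Definition virtually_free_pro_p (p : nat) (G : ProfGroup) :=
  exists H : set G, open_subgroup H /\ free_pro_p_subgroup p H.

(* elements of F_r = reduced words in the letters x_i^{+-1}, i < r;
   (i, false) stands for x_i and (i, true) for x_i^-1 *)
Definition word (r : nat) := seq ('I_r * bool).

Fixpoint reduced (r : nat) (w : word r) : bool :=
  match w with
  | a :: ((b :: _) as t) => ~~ ((a.1 == b.1) && (a.2 != b.2)) && reduced t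
  | _ => true
  end.

Definition eval_word (G : ProfGroup) (r : nat) (w : word r) (g : 'I_r -> G) : G :=
  foldr (fun a acc => pg_mul (if a.2 then pg_inv (g a.1) else g a.1) acc)
        (pg_one G) w.

Local Open Scope ring_scope.
Notation borelType K := (g_sigma_algebraType (@open K)).

Definition normalised_haar (K : ptopologicalType) (mul : K -> K -> K)
  (R : realType) (mu : {measure set (borelType K) -> \bar R}) :=
  [/\ mu setT = 1%E,
      (forall (g : K) (A : set (borelType K)), measurable A ->
          mu [set mul g x | x in A] = mu A),
      (forall A : set (borelType K), measurable A ->
          mu A = ereal_inf [set mu U | U in [set U : set K | open U /\ A `<=` U]])
    & (forall U : set K, open U ->
          mu U = ereal_sup [set mu C | C in [set C : set K | compact C /\ C `<=` U]])].

(* the product space carries a (pointed) instance; needed for Borel sets *)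
HB.instance Definition _ (U : Type) (T : U -> ptopologicalType) :=
  Pointed.copy (prod_topology T) (forall x, T x).

Definition pow_mul (G : ProfGroup) (r : nat) (x y : {ptws 'I_r -> G})
  : {ptws 'I_r -> G} := fun i => pg_mul (x i) (y i).

Definition probabilistic_identity (G : ProfGroup) (r : nat) (w : word r) :=
  [/\ reduced w, w != [::] &
    exists (R : realType) (mu : {measure set (borelType {ptws 'I_r -> G}) -> \bar R}),
      normalised_haar (@pow_mul G r) mu /\
      (0 < mu [set g : {ptws 'I_r -> G} | eval_word w g = pg_one G])%E].

Definition randomly_free (G : ProfGroup) :=
  forall (r : nat) (w : word r), ~ probabilistic_identity G w.

(* Main.v *)
Require Import Defs.
From HB Require Import structures.
From mathcomp Require Import all_boot all_order all_algebra all_fingroup.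
From mathcomp Require Import all_classical all_reals all_analysis.
From mathcomp Require Import zify.
Set Implicit Arguments. Unset Strict Implicit. Unset Printing Implicit Defensive.
Import Order.TTheory GRing.Theory Num.Theory.
Local Open Scope classical_set_scope.

(**
Let [H] be the open free pro-p subgroup, on a set with two distinct elements [a], [b]
(otherwise [H] is procyclic), and let [K] be the set of the elements of [G] that
centralise an open subgroup; then [K] is normal and meets [H] trivially.

For a reduced word [w], the set of [g] with [w(g)] in [K] is shown to be null by
induction on the length of [w].  Outside a null set (where a proper subword of [w]
takes a value in [K]) the prefixes [t_j] of [w(g)] are distinct modulo [K].  For [u] in
[N^r], with [N] an open normal subgroup of [G] inside [H],
[w(u g) w(g)^-1 = \prod_j t_j u_{i_j}^{e_j} t_j^-1], so that on the coset [N^r g] the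
solutions [u] lie in the kernel of [u |-> \sum_j e_j t_j u_{i_j}] on [N/[N,N]N^p].
If the element [D = \sum_j e_j t_j] (over the occurrences of one letter) of the group
algebra [F_p[G]] acts non-trivially on [N/[N,N]N^p], uniformly for all small [N], every
coset of [N^r] is at most half filled by solutions, and outer regularity of the Haar
measure makes the solution set null.

The non-triviality of [D]: if [D1] is the part of [D] in one coset of an open normal
subgroup and [D2] the rest, [D1 y D2 - D2 y D1] lies in the ideal generated by [D], is
supported on fewer cosets and, for a generic [y], has distinct group elements in its
support.  This reduces to [D] supported in [H], where the Fox derivative with respect to
[a], evaluated at a conjugate of a power of [a], detects [D].
*)

Declare Scope pg_scope.
Delimit Scope pg_scope with pg.
Local Notation "x * y" := (pg_mul x y) : pg_scope.
Local Notation "x ^-1" := (pg_inv x) : pg_scope.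
Local Notation "1" := (pg_one _) : pg_scope.
Local Open Scope pg_scope.

(** * Group identities and continuity of the operations *)

Section GroupIdentities.
Variable G : ProfGroup.
Implicit Types x y z : G.

Lemma pg_mulgV x : x * x^-1 = 1.
Proof.
rewrite -[x * _]pg_mul1g -{1}(pg_mulVg (x^-1)) -pg_mulA.
by rewrite (pg_mulA (x^-1) x) pg_mulVg pg_mul1g pg_mulVg.
Qed.

Lemma pg_mulg1 x : x * 1 = x.
Proof. by rewrite -(pg_mulVg x) pg_mulA pg_mulgV pg_mul1g. Qed.

Lemma pg_mulKg x y : x^-1 * (x * y) = y.
Proof. by rewrite pg_mulA pg_mulVg pg_mul1g. Qed.

Lemma pg_mulVKg x y : x * (x^-1 * y) = y.
Proof. by rewrite pg_mulA pg_mulgV pg_mul1g. Qed.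

Lemma pg_mulgI x y z : x * y = x * z -> y = z.
Proof. by move=> e; rewrite -(pg_mulKg x y) e pg_mulKg. Qed.

Lemma pg_invgK x : x^-1^-1 = x.
Proof. by apply: (@pg_mulgI (x^-1)); rewrite pg_mulgV pg_mulVg. Qed.

Lemma pg_invMg x y : (x * y)^-1 = y^-1 * x^-1.
Proof.
apply: (@pg_mulgI (x * y)); rewrite pg_mulgV -pg_mulA (pg_mulA y).
by rewrite pg_mulgV pg_mul1g pg_mulgV.
Qed.

Lemma pg_inv1 : (1 : G)^-1 = 1.
Proof. by rewrite -[_^-1]pg_mul1g pg_mulgV. Qed.

Lemma pg_mulgAr x y z : (x * y) * z = x * (y * z).
Proof. by rewrite pg_mulA. Qed.

Definition pgE := (pg_invMg, pg_invgK, pg_inv1, pg_mulgAr, pg_mul1g, pg_mulg1,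
  pg_mulVg, pg_mulgV, pg_mulKg, pg_mulVKg).

Lemma pg_eq_mulVg1 x y : x^-1 * y = 1 -> x = y.
Proof. by move=> e; rewrite -(pg_mulVKg x y) e pg_mulg1. Qed.

Lemma pg_mul_continuous (T : topologicalType) (f h : T -> G) :
  continuous f -> continuous h -> continuous (fun t => f t * h t).
Proof.
move=> cf ch t; apply: (@continuous2_cvg _ _ _ _ _ _ _ _ (fun x y => x * y)).
- exact: (@pg_mul_cont G (f t, h t)).
- exact: cf.
- exact: ch.
Qed.

Lemma pg_inv_continuous (T : topologicalType) (f : T -> G) :
  continuous f -> continuous (fun t => (f t)^-1).
Proof. by move=> cf t; apply: continuous_comp; [exact: cf|exact: pg_inv_cont]. Qed.

End GroupIdentities.

(** * Compact totally disconnected Hausdorff spaces *)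

Section Components.
Variable T : topologicalType.
Hypotheses (hT : hausdorff_space T) (cT : compact [set: T]).

(* In a compact Hausdorff space quasi-components are connected. *)
Lemma compact_totally_disconnected_zero_dimensional :
  totally_disconnected [set: T] -> zero_dimensional T.
Proof.
move=> tdT x y xy; apply: contrapT => nU.
have {nU} clopen_xy D : clopen D -> D x -> D y.
  by move=> cD Dx; apply: contrapT => nDy; apply: nU; exists D.
(* [Q] is the quasi-component of [x]. It contains [y], so its connectedness contradicts total
   disconnectedness. *)
pose Q := \bigcap_(D in [set D : set T | D x /\ clopen D]) D.
have Qx : Q x by move=> D [].
have Qy : Q y by move=> D [Dx cD]; exact: clopen_xy.
have cQ : closed Q by apply: closed_bigI => D [_ []].
suff : connected Q.
  move=> conQ; have : connected_component [set: T] x y by exists Q.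
  by rewrite tdT// => /esym/eqP; rewrite (negbTE xy).
move=> B [z Bz] [C oC BC] [D cD BD].
pose B' := Q `&` ~` C.
have cB : closed B by rewrite BD; exact: closedI.
have cB' : closed B' by apply: closedI => //; exact: open_closedC.
have nB : set_nbhs B (~` B').
  apply/set_nbhsP; exists (~` B'); split => //; first exact: closed_openC.
  by move=> t; rewrite BC => -[Qt Ct] [_].
have [U /set_nbhsP[W [oW BW WU]] clU] := compact_normal hT cT cB nB.
pose V := ~` closure U.
have oV : open V by exact/closed_openC/closed_closure.
have UV t : W t -> V t -> False.
  by move=> Wt; apply; apply: subset_closure; exact: WU.
have QWV : Q `<=` W `|` V.
  move=> t Qt; have [Ct|nCt] := pselect (C t).
    by left; apply: BW; rewrite BC.
  by right => /clU; apply; split.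
(* The clopen sets around [x] shrink to [Q]; the complement of the union of [W] and [V] being
   compact, one of them already avoids it. *)
have [E [[Ex clE] EWV]] : exists E, (E x /\ clopen E) /\ E `<=` W `|` V.
  pose F := filter_from [set D : set T | D x /\ clopen D] id.
  have FF : Filter F.
    apply: filter_from_filter; first by exists setT; split => //; exact: clopenT.
    by move=> A1 A2 [? ?] [? ?]; exists (A1 `&` A2) => //; split=> //; exact: clopenI.
  have PF : ProperFilter F by apply: filter_from_proper; move=> ? [? _]; exists x.
  have /(iffLR (compact_near_coveringP _)) : compact (~` (W `|` V)).
    apply: (subclosed_compact _ cT) => //; apply: open_closedC; exact: openU.
  move=> /(_ _ _ setC (powerset_filter_from_filter PF))[].
    move=> t nt; have /existsNP[A /not_implyP[[Ax [oA cA]] nAt]] : ~ Q t.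
      by move=> /QWV.
    exists (~` A, [set U0 | U0 `<=` A]); first split.
    - by apply: open_nbhs_nbhs; split => //; exact: closed_openC.
    - apply/near_powerset_filter_fromP; first by move=> ? ?; exact: subset_trans.
      by exists A => //; exists A.
    - by case=> i j [? /subsetC]; apply.
  move=> FD [DF _ [A FA]]/(_ _ FA)/subsetC2 AWV.
  have [E [Ex cE] EA] : F A by exact: DF.
  by exists E; split => //; exact: subset_trans EA _.
case: clE => oE cE.
have clEW : clopen (E `&` W).
  split; first exact: openI.
  rewrite (_ : _ `&` _ = E `&` ~` V); first by apply: closedI => //; exact: open_closedC.
  apply/seteqP; split=> t [Et]; first by move=> Wt; split=> // /(UV _ Wt).
  by move=> nVt; split => //; have [//|] := EWV _ Et.
have clEV : clopen (E `&` V).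
  split; first exact: openI.
  rewrite (_ : _ `&` _ = E `&` ~` W); first by apply: closedI => //; exact: open_closedC.
  apply/seteqP; split=> t [Et]; first by move=> Vt; split=> // /UV; apply.
  by move=> nVt; split => //; have [|//] := EWV _ Et.
(* [E] splits into two clopen pieces; the one containing [x] contains all of [Q]. *)
have [Wx|Vx] := EWV _ Ex.
- rewrite BC; apply/setIidPl => t Qt; apply: contrapT => nCt.
  have [_ Wt] : (E `&` W) t by apply: Qt.
  by apply: (UV t) => // /clU; apply; split.
- have Wz : W z by exact: BW.
  have [_ Vz] : (E `&` V) z by move: Bz; rewrite BC => -[Qz _]; apply: Qz.
  by have := UV _ Wz Vz.
Qed.

End Components.

(** * Open normal subgroups of a profinite group *)

Section OpenNormal.
Variable G : ProfGroup.
Implicit Types (x y z g : G) (N M H U V : set G).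

Definition onormal N := is_normal N /\ open N.

Lemma onormal1 N : onormal N -> N 1. Proof. by case=> -[[]]. Qed.

Lemma onormalM N x y : onormal N -> N x -> N y -> N (x * y).
Proof. by case=> -[[_ h _] _] _; exact: h. Qed.

Lemma onormalV N x : onormal N -> N x -> N (x^-1).
Proof. by case=> -[[_ _ h] _] _; exact: h. Qed.

Lemma onormalJ N g x : onormal N -> N x -> N (g * (x * g^-1)).
Proof. by case=> -[_ h] _ Nx; have := h (g^-1) _ Nx; rewrite pg_invgK. Qed.

Lemma onormalJV N g x : onormal N -> N x -> N (g^-1 * (x * g)).
Proof. by case=> -[_ h] _ Nx; exact: h. Qed.

Lemma onormalVr N x : onormal N -> N (x^-1) -> N x.
Proof. by move=> oN /(onormalV oN); rewrite pg_invgK. Qed.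

Lemma onormalC N x y : onormal N -> N (x * y) -> N (y * x).
Proof. by move=> oN /(onormalJV x oN); rewrite !pgE. Qed.

Lemma onormalI N M : onormal N -> onormal M -> onormal (N `&` M).
Proof.
move=> oN oM; split; last by apply: openI; [case: oN|case: oM].
split; last by move=> g n [Nn Mn]; split; exact: onormalJV.
split; first by split; exact: onormal1.
- by move=> x y [? ?] [? ?]; split; exact: onormalM.
- by move=> x [? ?]; split; exact: onormalV.
Qed.

Lemma onormalT : onormal [set: G].
Proof. by split=> //; exact: openT. Qed.

Lemma subgroup_open H : is_subgroup H -> nbhs (1 : G) H -> open H.
Proof.
move=> [H1 HM HV] nH; rewrite openE => x Hx.
have cx : continuous (fun y => x^-1 * y).
  by apply: pg_mul_continuous => ?; [exact: cst_continuous|exact: cvg_id].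
have : nbhs x ((fun y => x^-1 * y) @^-1` H) by apply: cx; rewrite pg_mulVg.
by apply: filterS => y /(HM _ _ Hx); rewrite pg_mulVKg.
Qed.

(** Inside [U] there is a clopen [C] around 1. The elements whose right translations, and those of
    their inverses, preserve [C] form a subgroup [V] inside [C], open because [C] is compact. The
    intersection [N] of the conjugates of [V] is open because [G] is compact. *)
Lemma onormal_base U : open U -> U (1 : G) -> exists2 N, onormal N & N `<=` U.
Proof.
move=> oU U1.
have zd := compact_totally_disconnected_zero_dimensional
  (@pg_hausdorff G) (@pg_compact G) (@pg_totdisc G).
have [C [C1 [oC cC]] CU] : filter_from [set D : set G | D 1 /\ clopen D] id U.
  by apply: zero_dimensional_cvg => //; [exact: pg_hausdorff|exact: pg_compact|
    exact: open_nbhs_nbhs].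
pose V := [set g : G | forall c, C c -> C (c * g) /\ C (c * g^-1)].
have sV : is_subgroup V.
  split=> [c Cc|x y Vx Vy c Cc|x Vx c Cc]; first by rewrite !pgE.
    split; first by rewrite pg_mulA; apply Vy, Vx.
    by rewrite pg_invMg pg_mulA; apply Vx, Vy.
  by rewrite pg_invgK; case: (Vx _ Cc).
have nV : nbhs (1 : G) V.
  have cptC : compact C by apply: subclosed_compact (@pg_compact G) _.
  pose P g c := C (c * g) /\ C (c * g^-1).
  apply: (iffLR (compact_near_coveringP _) cptC G (nbhs (1 : G)) P) => c Cc.
  have c1 : continuous (fun p : G * G => p.1 * p.2) := @pg_mul_cont G.
  have c2 : continuous (fun p : G * G => p.1 * p.2^-1).
    apply: pg_mul_continuous; first by move=> ?; exact: cvg_fst.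
    by apply: pg_inv_continuous => ?; exact: cvg_snd.
  have n1 : nbhs (c, 1 : G) ((fun p : G * G => p.1 * p.2) @^-1` C).
    by apply: c1 => /=; rewrite pg_mulg1; exact: open_nbhs_nbhs.
  have n2 : nbhs (c, 1 : G) ((fun p : G * G => p.1 * p.2^-1) @^-1` C).
    by apply: c2 => /=; rewrite pg_inv1 pg_mulg1; exact: open_nbhs_nbhs.
  exact: filterI n1 n2.
pose N := [set g : G | forall x, V (x^-1 * (g * x))].
have VC : V `<=` C by move=> g /(_ _ C1)[+ _]; rewrite pg_mul1g.
case: (sV) => V1 VM VV.
have sN : is_subgroup N.
  split=> [x|x y Nx Ny z|x Nx z]; first by rewrite !pgE.
    by have := VM _ _ (Nx z) (Ny z); rewrite !pgE.
  by have := VV _ (Nx z); rewrite !pgE.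
exists N; last first.
  by move=> g /(_ 1); rewrite !pgE => /VC/CU.
split; first by split => // g n Nn x; have := Nn (g * x); rewrite !pgE.
apply: subgroup_open => //.
have := (iffLR (compact_near_coveringP _) (@pg_compact G) G (nbhs (1 : G))
  (fun g x => V (x^-1 * (g * x)))).
have H : forall x : G, [set: G] x ->
   \forall x' \near x & i \near nbhs (1 : G), V (x'^-1 * (i * x')).
  move=> x _.
  have c2 : continuous (fun p : G * G => p.1^-1 * (p.2 * p.1)).
    apply: pg_mul_continuous.
      by apply: pg_inv_continuous => ?; exact: cvg_fst.
    by apply: pg_mul_continuous => ?; [exact: cvg_snd|exact: cvg_fst].
  suff : nbhs (x, 1 : G) ((fun p : G * G => p.1^-1 * (p.2 * p.1)) @^-1` V) by [].
  by apply: c2 => /=; rewrite !pgE.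
by move=> /(_ _ H); apply: filterS => g + x; apply.
Qed.

Lemma onormal_separate x : x <> 1 -> exists2 N, onormal N & ~ N x.
Proof.
move=> x1; have [N oN NU] : exists2 N, onormal N & N `<=` ~` [set x].
  apply: onormal_base; last by move=> /esym.
  apply: closed_openC; apply: accessible_closed_set1; apply: hausdorff_accessible.
  exact: pg_hausdorff.
by exists N => // /NU; exact.
Qed.

Lemma open_onormal_coset U x : open U -> U x ->
  exists2 N, onormal N & forall n, N n -> U (x * n).
Proof.
move=> oU Ux.
have cx : continuous (fun y => x * y).
  by apply: pg_mul_continuous => ?; [exact: cst_continuous|exact: cvg_id].
have [N oN NU] := @onormal_base ((fun y => x * y) @^-1` U)
  (open_comp (fun y _ => cx y) oU) ltac:(by rewrite /= pg_mulg1).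
by exists N.
Qed.

Lemma coset_open N x : onormal N -> open [set y : G | N (x^-1 * y)].
Proof.
move=> [_ oN]; apply: (open_comp _ oN) => y _.
by apply: pg_mul_continuous => ?; [exact: cst_continuous|exact: cvg_id].
Qed.

End OpenNormal.

(** * Finite groups as discrete profinite groups *)

Section FiniteGroup.
Variable gT : finGroupType.

Definition discrete_group := discrete_topology gT.
HB.instance Definition _ := DiscreteTopology.on discrete_group.
HB.instance Definition _ := isPointed.Build discrete_group (1%g : gT).

Let dmul (x y : discrete_group) : discrete_group := (x * y)%g.
Let dinv (x : discrete_group) : discrete_group := (x^-1)%g.

Lemma discrete_continuous (S : discreteTopologicalType) (T : topologicalType)
  (f : S -> T) : continuous f.
Proof.
by apply/continuousP => A _; exact: discrete_open.
Qed.

Lemma dmul_continuous : continuous (fun xy => dmul xy.1 xy.2).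
Proof.
move=> [x y] A nA.
exists ([set x], [set y]); first by split; exact: discrete_set1.
by case=> x' y' [/= -> ->]; exact: nbhs_singleton nA.
Qed.

Definition finite_ProfGroup : ProfGroup.
Proof.
refine (@Build_ProfGroup discrete_group dmul dinv (1%g : gT) _ _ _ _ _ _ _ _).
- exact: mulgA.
- exact: mul1g.
- exact: mulVg.
- exact: dmul_continuous.
- exact: discrete_continuous.
- by apply: finite_compact; exact: (@finite_finset gT setT).
- exact: discrete_hausdorff.
- exact/zero_dimension_totally_disconnected/discrete_zero_dimension.
Defined.

(** By Lagrange the number of cosets divides [p ^ k], hence is a power of [p]. *)
Lemma finite_ProfGroup_pro_p p k : prime p -> #|gT| = (p ^ k)%N ->
  is_pro_p finite_ProfGroup p.
Proof.
move=> pp cT; split=> // N [[N1 NM NV] _] _.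
pose NN := [set x : gT | `[< N x >]]%SET.
have NNP x : x \in NN <-> N x by rewrite finset.in_set; split=> /asboolP.
have gN : group_set NN.
  apply/group_setP; split; first exact/NNP.
  by move=> x y /NNP Nx /NNP Ny; apply/NNP; exact: (NM x y).
pose NG := Group gN.
pose E := enum (lcosets NG [set: gT]%G).
pose s : seq gT := [seq repr C | C : {set gT} <- E]%g.
have szs : size s = size E by rewrite size_map.
have EC i : (i < size s)%N -> (nth finset.set0 E i = nth 1%g s i *: NG)%g.
  rewrite szs => iE; rewrite (nth_map finset.set0)//.
  have := mem_nth finset.set0 iE; rewrite mem_enum => /lcosetsP[x _ ->].
  by apply/lcoset_eqP; rewrite lcoset_sym; exact: mem_repr (lcoset_refl NG x).
have : (size s %| p ^ k)%N.
  by rewrite szs -cardE card_lcosets -cT -cardsT dvdn_indexg.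
move=> /(dvdn_pfactor _ _ pp)[m _ szm].
exists m, s; split=> // [g|i j ilt jlt Nij].
- have gE : (g *: NG \in E)%g 
    by rewrite mem_enum; apply/lcosetsP; exists g => //; exact: finset.in_setT.
  have ilt : (index (g *: NG)%g E < size s)%N by rewrite szs index_mem.
  exists (index (g *: NG)%g E) => //.
  have : g \in (nth finset.set0 E (index (g *: NG) E))%g by rewrite nth_index ?lcoset_refl.
  rewrite EC// => /lcosetP[n] /NNP Nn eg.
  by exists n.
- apply/eqP; rewrite -(nth_uniq finset.set0 _ _ (enum_uniq (lcosets NG [set: gT]%G))) -?szs//.
  rewrite !EC//; apply/eqP; apply/lcoset_eqP; rewrite lcoset_sym mem_lcoset.
  exact/NNP.
Qed.

End FiniteGroup.

(** * Finite quotients by open normal subgroups *)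

Section Quotient.
Variables (G : ProfGroup) (N : set G).
Hypothesis oN : onormal N.

(** The quotient G/N is encoded by ordinals with a class map and a section, so that its operations
    are computed on representatives in [G]. *)
Record transversal_of := Transversal {
  tv_n : nat;
  tv_idx : G -> 'I_tv_n;
  tv_rep : 'I_tv_n -> G;
  tv_idxP : forall x y, tv_idx x = tv_idx y <-> N (x^-1 * y);
  tv_repK : cancel tv_rep tv_idx }.

Lemma index_pow_transversal p : index_pow N p ->
  exists (t : transversal_of) k, tv_n t = (p ^ k)%N.
Proof.
move=> [k [s [sk cov dis]]].
have /choice[idx idxP] : forall g, exists i : 'I_(size s), N ((nth 1 s i)^-1 * g).
  move=> g; have [i ilt [n Nn ->]] := cov g.
  by exists (Ordinal ilt); rewrite !pgE.
have idxE x y : idx x = idx y <-> N (x^-1 * y).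
  split=> [e|Nxy].
    have := onormalM oN (onormalV oN (idxP x)) (idxP y).
    by rewrite e !pgE.
  apply: ord_inj; apply: dis => //.
  have := onormalM oN (onormalM oN (idxP x) Nxy) (onormalV oN (idxP y)).
  by rewrite !pgE.
have repK : cancel (fun i : 'I_(size s) => nth 1 s i) idx.
  by move=> i; apply: ord_inj; apply: dis => //; exact: idxP.
by exists (Transversal idxE repK), k.
Qed.

Variable t : transversal_of.
Local Notation idx := (tv_idx t).
Local Notation rep := (tv_rep (t:=t)).

Lemma tv_rep_idx x : N (x^-1 * rep (idx x)).
Proof. by apply/(tv_idxP t); rewrite tv_repK. Qed.

Lemma tv_idxMr x y : idx (x * rep (idx y)) = idx (x * y).
Proof.
apply/esym/(tv_idxP t); have := tv_rep_idx y.
by rewrite !pgE.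
Qed.

Lemma tv_idxMl x y : idx (rep (idx x) * y) = idx (x * y).
Proof.
apply/esym/(tv_idxP t); have := onormalJV y oN (tv_rep_idx x).
by rewrite !pgE.
Qed.

Lemma tv_idxVl x y : idx ((rep (idx x))^-1 * y) = idx (x^-1 * y).
Proof.
apply/(tv_idxP t); have := onormalJV y oN (onormalC oN (tv_rep_idx x)).
by rewrite !pgE.
Qed.
End Quotient.

(** * Wreath products over a finite quotient *)

Section Wreath.
Variables (G : ProfGroup) (N : set G) (oN : onormal N) (t : transversal_of N).
Variable C : finZmodType.
Local Notation idx := (tv_idx t).
Local Notation rep := (tv_rep (t:=t)).
Local Open Scope ring_scope.

(* the wreath product [C wr G/N], with base group the functions [G/N -> C] *)
Definition wreath of onormal N := ({ffun 'I_(tv_n t) -> C} * 'I_(tv_n t))%type.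
HB.instance Definition _ := Finite.on (wreath oN).

(** G/N acts on functions by left translation, so that the first component of a homomorphism obeys
    the product rule of Fox derivatives. *)
Definition wr_mul (x y : wreath oN) : wreath oN :=
  ([ffun q => x.1 q + y.1 (idx ((rep x.2)^-1 * rep q)%pg)], idx (rep x.2 * rep y.2)%pg).
Definition wr_one : wreath oN := (0, idx 1%pg).
Definition wr_inv (x : wreath oN) : wreath oN :=
  ([ffun q => - x.1 (idx (rep x.2 * rep q)%pg)], idx ((rep x.2)^-1)%pg).

Lemma wr_mulA : associative wr_mul.
Proof.
move=> [f i] [g j] [h k]; congr pair => /=; last first.
  by rewrite (tv_idxMl oN) tv_idxMr pg_mulgAr.
apply/ffunP => q; rewrite !ffunE /= addrA; congr (_ + _ + h _).
by rewrite (tv_idxVl oN) tv_idxMr !pgE.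
Qed.

Lemma wr_mul1 : left_id wr_one wr_mul.
Proof.
move=> [g j]; congr pair => /=; last by rewrite (tv_idxMl oN) pg_mul1g tv_repK.
by apply/ffunP => q; rewrite !ffunE (tv_idxVl oN) !pgE tv_repK add0r.
Qed.

Lemma wr_mulV : left_inverse wr_one wr_inv wr_mul.
Proof.
move=> [g j]; congr pair => /=; last by rewrite (tv_idxMl oN) pg_mulVg.
by apply/ffunP => q; rewrite !ffunE (tv_idxVl oN) !pgE addNr.
Qed.

HB.instance Definition _ := Finite_isGroup.Build (wreath oN) wr_mulA wr_mul1 wr_mulV.

Lemma card_wreath p k l : tv_n t = (p ^ k)%N -> #|C| = (p ^ l)%N ->
  exists m, #|{: wreath oN}| = (p ^ m)%N.
Proof.
move=> nk cl; exists (l * tv_n t + k)%N.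
by rewrite card_prod card_ffun !card_ord cl expnD expnM -nk.
Qed.

End Wreath.

(** * Elements with open centraliser; non-trivial action of group algebra elements *)

Section Generalities.
Variable G : ProfGroup.

(** The normal subgroup called K above. *)
Definition vcent (g : G) :=
  exists2 N, onormal N & forall n, N n -> g * n = n * g.

Lemma vcentM x y : vcent x -> vcent y -> vcent (x * y).
Proof.
move=> [N oN xN] [M oM yM]; exists (N `&` M); first exact: onormalI.
by move=> n [Nn Mn]; rewrite pg_mulgAr yM// pg_mulA xN// pg_mulgAr.
Qed.

Lemma vcentV x : vcent x -> vcent (x^-1).
Proof.
move=> [N oN xN]; exists N => // n /xN e.
have : x^-1 * ((x * n) * x^-1) = x^-1 * ((n * x) * x^-1) by rewrite e.
by rewrite !pgE.
Qed.

Lemma vcent1 : vcent 1.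
Proof. by exists setT; [exact: onormalT|move=> n _; rewrite !pgE]. Qed.

Lemma vcentJ g x : vcent x -> vcent (g^-1 * (x * g)).
Proof.
move=> [N oN xN]; exists N => // n Nn.
have := xN _ (onormalJ g oN Nn) => e.
have : g^-1 * ((x * (g * (n * g^-1))) * g) = g^-1 * (((g * (n * g^-1)) * x) * g) by rewrite e.
by rewrite !pgE.
Qed.

Lemma vcentJV g x : vcent (g^-1 * (x * g)) -> vcent x.
Proof. by move=> /(vcentJ (g^-1)); rewrite !pgE. Qed.

(** A finite Baire argument: each closed set has empty interior in [O], so removing them one at a
    time always leaves a non-empty open set. *)
Lemma avoid_closed (I : eqType) (r : seq I) (Z : I -> set G) (O : set G) :
  open O -> O !=set0 ->
  (forall i, i \in r -> closed (Z i) /\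
    forall O', open O' -> O' !=set0 -> O' `<=` O -> exists2 y, O' y & ~ Z i y) ->
  exists2 y, O y & forall i, i \in r -> ~ Z i y.
Proof.
elim: r O => [|i r IH] O oO O0 hZ; first by case: O0 => y Oy; exists y.
have [cZ /(_ O oO O0 (@subset_refl _ O))[y Oy nZy]] := hZ i (mem_head _ _).
have [|||z [Oz nZz] hz] := IH (O `&` ~` Z i).
- by apply: openI => //; exact: closed_openC.
- by exists y.
- move=> j jr; have [|cj hj] := hZ j; first by rewrite inE jr orbT.
  split=> // O' oO' O'0 O'O; apply: hj => //.
  by apply: subset_trans O'O _; exact: subIsetl.
exists z => // j; rewrite inE => /predU1P[->//|]; exact: hz.
Qed.

Lemma onormal_all (I : eqType) (r : seq I) (Q : I -> set G -> Prop) :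
  (forall i (N M : set G), M `<=` N -> Q i N -> Q i M) ->
  (forall i, i \in r -> exists2 N, onormal N & Q i N) ->
  exists2 V, onormal V & forall i, i \in r -> Q i V.
Proof.
move=> mono; elim: r => [|i r IH] hQ; first by exists setT => //; exact: onormalT.
have [V oV hV] : exists2 V, onormal V & forall i, i \in r -> Q i V.
  by apply: IH => j jr; apply: hQ; rewrite inE jr orbT.
have [N oN QN] := hQ i (mem_head _ _).
exists (V `&` N); first exact: onormalI.
move=> j; rewrite inE => /predU1P[->|/hV QV].
  exact: (mono _ _ _ (@subIsetr _ V N) QN).
exact: (mono _ _ _ (@subIsetl _ V N) QV).
Qed.

Variable p : nat.
Local Open Scope ring_scope.

(* the element [\sum_i c_i t_i] of the group algebra acts as 0 on [N/[N,N]N^p] *)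
Definition kills (N : set G) (I : finType) (P : pred I) (c : I -> 'F_p) (t : I -> G) :=
  forall chi : G -> 'F_p,
  (forall u v, N u -> N v -> chi (u * v)%pg = chi u + chi v) ->
  forall u, N u -> \sum_(i | P i) c i * chi (t i * (u * (t i)^-1))%pg = 0.

(** Allowing perturbed elements [t'] makes the property open in [t]; compactness can then provide
    one [V] for a whole family of tuples. *)
Definition robust (I : finType) (P : pred I) (c : I -> 'F_p) (t : I -> G) :=
  exists2 V, onormal V & forall t' : I -> G, (forall i, P i -> V ((t i)^-1 * t' i)%pg) ->
    forall N, onormal N -> N `<=` V -> ~ kills N P c t'.

(** The factor [x] is absorbed by conjugating the character [chi], the factor [y] by conjugating
    [u]. *)
Lemma kills_shift N (I : finType) (P : pred I) (c : I -> 'F_p) (t : I -> G) x y :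
  onormal N -> kills N P c t -> kills N P c (fun i => x * (t i * y))%pg.
Proof.
move=> oN kN chi chiM u Nu.
have := kN (fun v => chi (x * (v * x^-1))%pg) _ _ (onormalJ y oN Nu).
have h : forall u0 v : G, N u0 -> N v ->
  chi (x * ((u0 * v) * x^-1))%pg = chi (x * (u0 * x^-1))%pg + chi (x * (v * x^-1))%pg.
  move=> v w Nv Nw; rewrite -chiM; [|exact: onormalJ|exact: onormalJ].
  by rewrite !pgE.
by move=> /(_ h) e; rewrite -[RHS]e; apply: eq_bigr => i _; rewrite !pgE.
Qed.

Lemma robust_shift (I : finType) (P : pred I) (c : I -> 'F_p) (t : I -> G) y :
  robust P c (fun i => t i * y)%pg -> robust P c t.
Proof.
move=> [V oV hV]; exists V => // t' tt' N oN NV kN.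
apply: (hV (fun i => t' i * y)%pg _ N oN NV); last first.
  by move: (kills_shift 1%pg y oN kN) => /=; rewrite (_ : (fun _ => _) = fun i => t' i * y)%pg//;
     apply/funext => i; rewrite pg_mul1g.
by move=> i Pi; have := onormalJV y oV (tt' i Pi); rewrite !pgE.
Qed.

End Generalities.

(** * Elimination of a coset from the support *)

Section Elimination.
Variables (G : ProfGroup) (p : nat) (N : set G) (oN : onormal N).
Local Open Scope ring_scope.
Variables (I : finType) (P P1 : pred I) (c : I -> 'F_p) (t : I -> G) (y : G).

(** Indexes the terms of [D1 y D2 - D2 y D1]: in [(s, (i, j))], [i] belongs to [D1] and [j] to [D2],
    and [s = true] selects the product [D2 y D1], with sign -1. *)
Definition elim_pred (k : bool * (I * I)) := (P k.2.1 && P1 k.2.1) && (P k.2.2 && ~~ P1 k.2.2).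
Definition elim_coef (k : bool * (I * I)) : 'F_p := (-1) ^+ k.1 * (c k.2.1 * c k.2.2).
Definition elim_left (k : bool * (I * I)) := if k.1 then k.2.2 else k.2.1.
Definition elim_right (k : bool * (I * I)) := if k.1 then k.2.1 else k.2.2.
Definition elim_elt (k : bool * (I * I)) : G := (t (elim_left k) * (y * t (elim_right k)))%pg.

(* If [D = D1 + D2], with [D1] the part of [D] indexed by [P1], this says that
   [D1 y D2 - D2 y D1 = D1 y D - D y D1]. *)
Lemma kills_elim : kills N P c t -> kills N elim_pred elim_coef elim_elt.
Proof.
move=> kN chi chiM u Nu.
pose f i j := chi ((t i * (y * t j)) * (u * (t i * (y * t j))^-1))%pg.
pose Q1 i := P i && P1 i; pose Q2 i := P i && ~~ P1 i.
have f1 i : \sum_(j | P j) c j * f i j = 0.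
  have := kills_shift (t i * y)%pg 1%pg oN kN chiM Nu => e; rewrite -[RHS]e.
  by apply: eq_bigr => j _; rewrite /f !pgE.
have f2 j : \sum_(i | P i) c i * f i j = 0.
  have := kills_shift 1%pg (y * t j)%pg oN kN chiM Nu => e; rewrite -[RHS]e.
  by apply: eq_bigr => i _; rewrite /f !pgE.
have {}f1 i : \sum_(j | Q2 j) c j * f i j = - \sum_(j | Q1 j) c j * f i j.
  by apply/eqP; rewrite -addr_eq0 addrC -bigID f1.
have {}f2 j : \sum_(i | Q2 i) c i * f i j = - \sum_(i | Q1 i) c i * f i j.
  by apply/eqP; rewrite -addr_eq0 addrC -bigID f2.
have -> : \sum_(k | elim_pred k) elim_coef k * chi (elim_elt k * (u * (elim_elt k)^-1))%pg =
   \sum_(s : bool) \sum_(k : I * I | Q1 k.1 && Q2 k.2)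
     (-1) ^+ s * (c k.1 * c k.2 * (if s then f k.2 k.1 else f k.1 k.2)).
  rewrite pair_big_dep /=; apply: eq_big => [[s [i j]]//|[s [i j]] _].
  by rewrite /elim_coef /elim_elt /elim_left /elim_right -!mulrA /=; case: s.
rewrite big_bool /= expr1 expr0.
(* By [f2] and [f1], both halves turn into the double sum of [D1 y D1], with opposite signs. *)
have -> : \sum_(k : I * I | Q1 k.1 && Q2 k.2) -1 * (c k.1 * c k.2 * f k.2 k.1) =
   \sum_(i | Q1 i) \sum_(j | Q1 j) c i * c j * f j i.
  rewrite -(pair_big_dep Q1 (fun _ => Q2) (fun i j => -1 * (c i * c j * f j i))) /=.
  apply: eq_bigr => i _; transitivity (- c i * \sum_(j | Q2 j) c j * f j i).
    by rewrite mulr_sumr; apply: eq_bigr => j _; rewrite mulN1r mulNr mulrA.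
  by rewrite f2 mulrNN mulr_sumr; apply: eq_bigr => j _; rewrite mulrA.
have -> : \sum_(k : I * I | Q1 k.1 && Q2 k.2) 1 * (c k.1 * c k.2 * f k.1 k.2) =
   - \sum_(i | Q1 i) \sum_(j | Q1 j) c i * c j * f i j.
  rewrite -(pair_big_dep Q1 (fun _ => Q2) (fun i j => 1 * (c i * c j * f i j))) /= -sumrN.
  apply: eq_bigr => i _; transitivity (c i * \sum_(j | Q2 j) c j * f i j).
    by rewrite mulr_sumr; apply: eq_bigr => j _; rewrite mul1r mulrA.
  by rewrite f1 mulrN mulr_sumr; congr (- _); apply: eq_bigr => j _; rewrite mulrA.
apply/eqP; rewrite subr_eq0 exchange_big; apply/eqP.
by apply: eq_bigr => i _; apply: eq_bigr => j _; rewrite (mulrC (c j)).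
Qed.

End Elimination.

(** As [V] is normal, perturbing each [t i] modulo [V] only perturbs the products [t i y t j] modulo
    [V]. *)
Lemma robust_elim (G : ProfGroup) (p : nat) (I : finType) (P P1 : pred I) (c : I -> 'F_p)
    (t : I -> G) (y : G) :
  robust (elim_pred P P1) (elim_coef c) (elim_elt t y) -> robust P c t.
Proof.
move=> [V oV hV]; exists V => // t' tt' N oN NV kN.
apply: (hV (elim_elt t' y) _ N oN NV); last exact: kills_elim.
move=> [s [i j]] /andP[/= /andP[Pi _] /andP[Pj _]].
have h k l : P k -> P l -> V ((t k * (y * t l))^-1 * (t' k * (y * t' l)))%pg.
  move=> Pk Pl.
  have := onormalM oV (onormalJV (y * t l)%pg oV (tt' _ Pk)) (tt' _ Pl).
  by rewrite !pgE.
by case: s; exact: h.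
Qed.

(** * Word maps and their Fox derivatives *)

Section Words.
Variables (G : ProfGroup) (r : nat).
Implicit Types (w : word r) (g u : 'I_r -> G).

Definition letter_cancel (x y : 'I_r * bool) := (x.1 == y.1) && (x.2 != y.2).

Lemma reducedE w : reduced w = sorted (fun x y => ~~ letter_cancel x y) w.
Proof.
elim: w => // x [|y w] //= IH; congr (_ && _).
by rewrite [LHS]IH.
Qed.

Lemma eval_word_cat w w' g : eval_word (w ++ w') g = eval_word w g * eval_word w' g.
Proof. by elim: w => [|x w IH]; rewrite /= ?pg_mul1g// -!/(eval_word _ g) IH pg_mulA. Qed.

Lemma eval_word_continuous w :
  continuous (fun g : {ptws 'I_r -> G} => eval_word w g).
Proof.
elim: w => [|[i s] w IH]; first exact: cst_continuous.
apply: pg_mul_continuous => //=; case: s => /=.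
  by apply: pg_inv_continuous; exact: proj_continuous.
exact: proj_continuous.
Qed.

(** The prefix includes the letter itself exactly when that letter is an inverse, since the Fox
    derivative of x^-1 is -x^-1. *)
Definition prefix_at w g (j : 'I_(size w)) : G :=
  eval_word (take (j + (tnth (in_tuple w) j).2) w) g.

Definition twist u g : 'I_r -> G := fun i => u i * g i.

Local Open Scope ring_scope.

Lemma eval_word_twist_onormal (N : set G) w u g : onormal N -> (forall i, N (u i)) ->
  N (eval_word w (twist u g) * (eval_word w g)^-1)%pg.
Proof.
move=> oN Nu; elim: w => [|[i s] w IH]; first by rewrite /= !pgE; exact: onormal1.
rewrite /= -!/(eval_word _ _); set E := eval_word w _ in IH *; set E0 := eval_word w _ in IH *.
case: s; rewrite /twist.
- have := onormalM oN (onormalJV (g i) oN (onormalV oN (Nu i))) (onormalJV (g i) oN IH).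
  by rewrite !pgE.
- by have := onormalM oN (Nu i) (onormalJ (g i) oN IH); rewrite !pgE.
Qed.

(* the Fox derivative of the word map, evaluated on an additive character of [N] *)
Lemma eval_word_twist (N : set G) (C : nzRingType) (chi : G -> C) w u g :
  onormal N -> (forall x y, N x -> N y -> chi (x * y)%pg = chi x + chi y) ->
  (forall i, N (u i)) ->
  chi (eval_word w (twist u g) * (eval_word w g)^-1)%pg =
  \sum_(j < size w) (-1) ^+ (tnth (in_tuple w) j).2 *
     chi (prefix_at g j * (u (tnth (in_tuple w) j).1 * (prefix_at g j)^-1))%pg.
Proof.
move=> oN chiM Nu.
have chi1 (f : G -> C) : (forall x y, N x -> N y -> f (x * y)%pg = f x + f y) -> f 1%pg = 0.
  move=> fM; have := fM 1%pg 1%pg (onormal1 oN) (onormal1 oN); rewrite pg_mul1g => /eqP.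
  by rewrite -subr_eq0 opprD addrA subrr sub0r oppr_eq0 => /eqP.
elim: w chi chiM => [|x w IH] chi chiM; first by rewrite big_ord0 /= !pgE chi1.
rewrite big_ord_recl.
pose y := eval_word [:: x] g.
have NE := eval_word_twist_onormal w g oN Nu.
(* Splitting off the first letter [y] conjugates the rest by [y], so the induction hypothesis is
   applied to the conjugated character. *)
have := IH (fun v => chi (y * (v * y^-1))%pg); set S := bigop _ _ _; set S' := bigop _ _ _.
have -> : S' = S.
  apply: eq_bigr => j _.
  have tj : tnth (in_tuple (x :: w)) (lift ord0 j) = tnth (in_tuple w) j.
    by rewrite !(tnth_nth x).
  have pj : @prefix_at (x :: w) g (lift ord0 j) = (y * prefix_at g j)%pg.
    by rewrite /prefix_at tj -eval_word_cat.
  by rewrite tj pj !pgE.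
move=> h; rewrite -{}h; last first.
  move=> a b Na Nb; rewrite -chiM; [|exact: onormalJ|exact: onormalJ].
  by rewrite !pgE.
rewrite /prefix_at (tnth_nth x) /=.
have NJ := onormalJ y oN NE.
case: x @y S S' NJ => i [] y S S'; rewrite /y /= ?pgE => NJ;
  rewrite ?expr1 ?expr0 ?mulN1r ?mul1r ?take0 /= ?pgE /twist ?pgE.
  have NV := onormalJV (g i) oN (Nu i).
  have NV' := onormalJV (g i) oN (onormalV oN (Nu i)).
  have -> : chi ((g i)^-1 * (u i * g i))%pg = - chi ((g i)^-1 * ((u i)^-1 * g i))%pg.
    by apply/eqP; rewrite -addr_eq0 -chiM // !pgE chi1.
  by rewrite opprK -chiM // !pgE.
by rewrite -chiM // !pgE.
Qed.

End Words.

(** * Topology of the powers of [G] *)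

Section Powers.
Variables (G : ProfGroup) (r : nat).
Local Notation GR := {ptws 'I_r -> G}.

Lemma GR_compact : compact [set: GR].
Proof.
have := @tychonoff 'I_r (fun=> G : topologicalType) (fun=> setT) (fun=> @pg_compact G).
by congr compact; apply/seteqP; split.
Qed.

Lemma GR_box_nbhs (g : GR) (V : set G) : onormal V ->
  nbhs g [set h : GR | forall i, V ((g i)^-1 * h i)].
Proof.
move=> oV.
apply: (@filter_forall _ _ (fun i => [set h : GR | V ((g i)^-1 * h i)]) (nbhs g)) => i.
have ci : continuous (fun h : GR => h i) by exact: proj_continuous.
apply: (ci g [set y | V ((g i)^-1 * y)]); apply: open_nbhs_nbhs; split; first exact: coset_open.
by rewrite /= pg_mulVg; exact: onormal1.
Qed.

(** Compactness in the near-covering form, for the filter [F] of properties shared by all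
    sufficiently small open normal subgroups. *)
Lemma onormal_uniform (T : topologicalType) (S : set T) (Q : set G -> T -> Prop) :
  compact S ->
  (forall g, S g -> exists2 V, onormal V &
     \forall g' \near g, forall N, onormal N -> N `<=` V -> Q N g') ->
  exists2 V, onormal V & forall N, onormal N -> N `<=` V -> forall g, S g -> Q N g.
Proof.
move=> /compact_near_coveringP cS hQ.
pose F : set_system (set G) := fun A => exists2 V, onormal V &
  forall N, onormal N -> N `<=` V -> A N.
have FF : Filter F.
  apply: Build_Filter.
  - by exists setT; [exact: onormalT|].
  - move=> A B [V oV hA] [W oW hB]; exists (V `&` W); first exact: onormalI.
    by move=> N oN NVW; split; [apply: hA|apply: hB] => // x /NVW[].
  - by move=> A B AB [V oV hA]; exists V => // N oN NV; apply: AB; exact: hA.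
have [|V oV hV] := cS _ F (fun N g => onormal N -> Q N g) FF.
  move=> g /hQ[V oV hV].
  exists ([set g' | forall N, onormal N -> N `<=` V -> Q N g'], [set N | N `<=` V]).
    by split => //=; exists V.
  by move=> [g' N] [/= h NV] oN; exact: h.
by exists V => // N oN NV g Sg; exact: (hV N oN NV g Sg oN).
Qed.

(** A point outside [U] differs from [g] in some coordinate, which a small [V] detects; compactness
    of the complement of [U] makes [V] uniform. *)
Lemma GR_box_open (g : GR) (U : set GR) : open U -> U g ->
  exists2 V, onormal V & forall h : GR, (forall i, V ((g i)^-1 * h i)) -> U h.
Proof.
move=> oU Ug.
have cU : compact (~` U).
  by apply: subclosed_compact GR_compact _ => //; exact: open_closedC.
have [|V oV hV] := @onormal_uniform GR (~` U)
   (fun N h => ~ forall i, N ((g i)^-1 * h i)) cU.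
  move=> h nUh; have [i hi] : exists i, g i <> h i.
    by apply/existsNP => e; apply: nUh; rewrite (_ : h = g)//; apply/funext => i; rewrite e.
  have /onormal_separate[V oV nV] : (g i)^-1 * h i <> 1 by move=> /pg_eq_mulVg1.
  exists V => //; apply: filterS (GR_box_nbhs h oV) => h' Vh' N oN NV /(_ i) /NV Vi.
  apply: nV; have := onormalM oV Vi (onormalV oV (Vh' i)).
  by rewrite !pgE.
by exists V => // h hh; apply: contrapT => /(hV V oV (@subset_refl _ V)); exact.
Qed.

(** A Lebesgue number lemma, with open normal subgroups as radii. *)
Lemma GR_uniform_box (S U : set GR) : closed S -> open U -> S `<=` U ->
  exists2 V, onormal V & forall N, onormal N -> N `<=` V -> forall g, S g ->
    forall h : GR, (forall i, N ((g i)^-1 * h i)) -> U h.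
Proof.
move=> cS oU SU; apply: (@onormal_uniform GR S
  (fun N g => forall h : GR, (forall i, N ((g i)^-1 * h i)) -> U h)).
  exact: subclosed_compact GR_compact _.
move=> g /SU /(GR_box_open oU)[V oV hV]; exists V => //.
apply: filterS (GR_box_nbhs g oV) => g' Vg' N oN NV h Nh; apply: hV => i.
by have := onormalM oV (Vg' i) (NV _ (Nh i)); rewrite !pgE.
Qed.

End Powers.

(** * Haar measure on the powers of [G] *)

Section BorelPowers.
Variables (G : ProfGroup) (r : nat) (R : realType).
Local Notation GR := {ptws 'I_r -> G}.
Local Open Scope ring_scope.
Variable mu : {measure set (borelType GR) -> \bar R}.
Local Open Scope ereal_scope.

Lemma open_borel (U : set GR) : open U -> measurable (U : set (borelType GR)).
Proof. by move=> oU; exact: sub_sigma_algebra. Qed.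

Lemma closed_borel (Z : set GR) : closed Z -> measurable (Z : set (borelType GR)).
Proof.
move=> cZ; rewrite -(setCK Z); apply: measurableC; apply: open_borel.
exact: closed_openC.
Qed.

Lemma closed_null_union (I : eqType) (s : seq I) (Z : I -> set GR) :
  (forall i, i \in s -> closed (Z i) /\ mu (Z i) = 0) ->
  exists Z0, [/\ closed Z0, mu Z0 = 0 & forall i, i \in s -> Z i `<=` Z0].
Proof.
elim: s => [|i s IH] hZ.
  by exists set0; split; [exact: closed0|exact: measure0|].
have [Z0 [cZ0 mZ0 sZ0]] := IH (fun j js => hZ j (mem_behead (s := i :: s) js)).
have [cZ mZ] := hZ i (mem_head _ _).
exists (Z0 `|` Z i); split; first exact: closedU.
- by rewrite measureU0//; exact: closed_borel.
- move=> j; rewrite inE => /predU1P[->|/sZ0 h]; first exact: subsetUr.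
  by apply: subset_trans h _; exact: subsetUl.
Qed.

Hypothesis haar : normalised_haar (@pow_mul G r) mu.

Lemma haar_le (A B : set GR) : measurable (A : set (borelType GR)) ->
  measurable (B : set (borelType GR)) -> A `<=` B -> mu A <= mu B.
Proof. by move=> mA mB AB; apply: le_measure => //; rewrite inE. Qed.

Lemma haar_fin (A : set GR) : measurable (A : set (borelType GR)) -> mu A \is a fin_num.
Proof.
move=> mA; rewrite ge0_fin_numE//; apply: (@le_lt_trans _ _ 1); last exact: ltry.
case: haar => <- _ _ _; exact: haar_le.
Qed.

Lemma haar_outer (A : set GR) (e : \bar R) : measurable (A : set (borelType GR)) ->
  mu A < e -> exists U : set GR, [/\ open U, A `<=` U & mu U < e].
Proof.
move=> mA; case: haar => _ _ outer _; rewrite outer// => /ereal_inf_lt[_ [U [oU AU] <-] Ue].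
by exists U.
Qed.

Lemma haar_translate_closed (v : GR) (T : set GR) : closed T ->
  closed [set pow_mul v x | x in T] /\ mu [set pow_mul v x | x in T] = mu T.
Proof.
move=> cT; split; last by case: haar => _ + _ _; apply; exact: closed_borel.
rewrite -openC openE => y /= nTy.
pose z : GR := fun i => ((v i)^-1 * y i)%pg.
have nTz : (~` T) z.
  by move=> Tz; apply: nTy; exists z => //; apply/funext => i; rewrite /pow_mul pg_mulVKg.
have [V oV hV] := GR_box_open (closed_openC cT) nTz.
apply: filterS (GR_box_nbhs y oV) => h Vh /= [x Tx xh]; apply: (hV x) => // i.
by have := Vh i; rewrite -xh /z /pow_mul !pgE.
Qed.

Variables (N : set G) (oN : onormal N) (tv : transversal_of N).

Definition coset_index (g : GR) : {ffun 'I_r -> 'I_(tv_n tv)} := [ffun i => tv_idx tv (g i)].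

Lemma coset_indexP (g h : GR) :
  coset_index g = coset_index h <-> forall i, N ((g i)^-1 * h i)%pg.
Proof.
split=> [/ffunP e i|e]; last by apply/ffunP => i; rewrite !ffunE; apply/(tv_idxP tv).
by have := e i; rewrite !ffunE => /(tv_idxP tv).
Qed.

Lemma coset_index_open (Q : set {ffun 'I_r -> 'I_(tv_n tv)}) :
  open [set g : GR | Q (coset_index g)].
Proof.
rewrite openE => g /= Qg; apply: filterS (GR_box_nbhs g oN) => h /coset_indexP e /=.
by rewrite -e.
Qed.

Lemma coset_index_closed (Q : set {ffun 'I_r -> 'I_(tv_n tv)}) :
  closed [set g : GR | Q (coset_index g)].
Proof. by rewrite -openC; exact: (coset_index_open (~` Q)). Qed.

(** The inequality is summed over the finitely many cosets, added one at a time along a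
    duplicate-free list. *)
Lemma coset_index_double (A B : set GR) :
  measurable (A : set (borelType GR)) -> measurable (B : set (borelType GR)) ->
  (forall o, mu (A `&` [set g | coset_index g = o]) + mu (A `&` [set g | coset_index g = o]) <=
     mu (B `&` [set g | coset_index g = o])) ->
  mu A + mu A <= mu B.
Proof.
move=> mA mB hAB.
pose D (s : seq {ffun 'I_r -> 'I_(tv_n tv)}) := [set g : GR | coset_index g \in s].
have mD s : measurable (D s : set (borelType GR)).
  by apply: open_borel; exact: (coset_index_open [set o | o \in s]).
pose E o := [set g : GR | coset_index g = o].
have mE o : measurable (E o : set (borelType GR)).
  by apply: open_borel; exact: (coset_index_open [set o' | o' = o]).
have DE o s C : measurable (C : set (borelType GR)) -> o \notin s ->
    mu (C `&` D (o :: s)) = mu (C `&` E o) + mu (C `&` D s).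
  move=> mC os; rewrite -measureU; [|exact: measurableI|exact: measurableI|]; last first.
    by apply/seteqP; split=> // g [[_ Eg] [_]]; rewrite /D /= Eg (negbTE os).
  congr (mu _); apply/seteqP; split=> g.
    by move=> [Cg]; rewrite /D /= inE => /predU1P[e|Dg]; [left|right].
  by move=> [[Cg e]|[Cg Dg]]; split => //; rewrite /D /= inE; apply/predU1P; [left|right].
have key s : uniq s -> mu (A `&` D s) + mu (A `&` D s) <= mu (B `&` D s).
  elim: s => [_|o s IH /= /andP[os us]].
    by rewrite (_ : D [::] = set0) ?setI0 ?measure0 ?adde0//; apply/seteqP; split.
  rewrite !DE// addeACA; apply: leeD; [exact: hAB|exact: IH].
have := key _ (enum_uniq {: {ffun 'I_r -> 'I_(tv_n tv)}}).
have -> : D (enum {: {ffun 'I_r -> 'I_(tv_n tv)}}) = setT.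
  by apply/seteqP; split => // g _; rewrite /D /= mem_enum.
by rewrite !setIT.
Qed.

End BorelPowers.

(** * The open free pro-p subgroup; powers modulo open normal subgroups *)

Section FreeProP.
Variables (p : nat) (G : ProfGroup) (H : set G) (X : Type) (iota : X -> G).
Hypothesis proG : is_pro_p G p.
Hypotheses (sH : is_subgroup H) (oH : open H).
Hypotheses (Hiota : forall x, H (iota x)) (iota1 : conv_to_one iota).
Hypothesis univ : forall K : ProfGroup, is_pro_p K p ->
  forall f : X -> K, conv_to_one f -> exists phi : G -> K,
    [/\ is_hom_on H phi, {within H, continuous phi},
      (forall x, phi (iota x) = f x) &
      forall psi : G -> K, is_hom_on H psi -> {within H, continuous psi} ->
        (forall x, psi (iota x) = f x) -> forall h, H h -> psi h = phi h].

Let H1 : H 1. Proof. by case: sH. Qed.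
Let HM x y : H x -> H y -> H (x * y). Proof. by case: sH => _ h _; exact: h. Qed.
Let HV x : H x -> H (x^-1). Proof. by case: sH => _ _ h; exact: h. Qed.

Lemma onormal_transversal (N : set G) : onormal N ->
  exists (t : transversal_of N) k, tv_n t = (p ^ k)%N.
Proof.
move=> oN; apply: (index_pow_transversal oN).
by case: proG => _; apply; case: oN.
Qed.

Definition pw (g : G) n := iter n (pg_mul g) 1.

Lemma pwD g m n : pw g (m + n) = pw g m * pw g n.
Proof. by elim: m => [|m IH]; rewrite /pw /= ?pgE// -/(pw g _) IH. Qed.

Lemma pw1 g : pw g 1 = g. Proof. by rewrite /pw /= pg_mulg1. Qed.

Lemma pwSr g n : pw g n.+1 = pw g n * g.
Proof. by rewrite -addn1 pwD pw1. Qed.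

Lemma pw_order g (N : set G) : onormal N -> exists2 m, (0 < m)%N & N (pw g m).
Proof.
move=> oN; have [t _] := onormal_transversal oN.
apply: contrapT => nm.
have inj : injective (fun i : 'I_(tv_n t).+1 => tv_idx t (pw g i)).
  have lt i j : (i < j)%N -> tv_idx t (pw g i) <> tv_idx t (pw g j).
    move=> ij /(tv_idxP t); rewrite -(subnKC (ltnW ij)) pwD pg_mulKg => Nij.
    by apply: nm; exists (j - i)%N => //; rewrite subn_gt0.
  move=> i j e; apply: ord_inj; have [/lt|/lt|//] := ltngtP i j => /(_ _)//.
  by move=> /(_ (esym e)).
by have := leq_card _ inj; rewrite !card_ord ltnn.
Qed.

Lemma pwV g n (N : set G) : onormal N -> exists m, N (pw g n * pw g m).
Proof.
move=> oN; have [[//|m] _ Nm] := pw_order g oN; exists (n * m)%N.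
rewrite -pwD -mulnS; elim: n => [|n IH]; first exact: onormal1.
by rewrite mulSn pwD; exact: onormalM.
Qed.

(** * Maps from [G] to the wreath product *)

Section FixN.
Variables (N : set G) (oN : onormal N) (t : transversal_of N) (k l : nat).
Hypothesis tk : tv_n t = (p ^ k)%N.
Variable C : finZmodType.
Hypothesis Cl : #|C| = (p ^ l)%N.
Local Notation W := (finite_ProfGroup (wreath t C oN)).

Definition wr_pair (f : G -> C) (g : G) : W :=
  ([ffun q => f (tv_rep q)], tv_idx t g).

Definition wr_fun (w : W) (q : G) : C := (w : wreath t C oN).1 (tv_idx t q).

Lemma wreath_pro_p : is_pro_p W p.
Proof.
case: proG => pp _; have [m cm] := card_wreath oN tk Cl.
exact: finite_ProfGroup_pro_p pp cm.
Qed.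

Local Open Scope ring_scope.

Lemma wr_fun_pair f g q : (forall x y, N (x^-1 * y)%pg -> f x = f y) ->
  wr_fun (wr_pair f g) q = f q.
Proof.
by move=> fN; rewrite /wr_fun /= ffunE; apply/esym/fN; exact: (tv_rep_idx t).
Qed.

Lemma wr_pairM f g f' g' : (forall x y, N (x^-1 * y)%pg -> f' x = f' y) ->
  (wr_pair f g * wr_pair f' g')%pg =
  wr_pair (fun q => f q + f' (g^-1 * q)%pg) (g * g')%pg.
Proof.
move=> fN; congr pair; last by rewrite (tv_idxMl oN) tv_idxMr.
apply/ffunP => q; rewrite !ffunE; congr (_ + _); rewrite (tv_idxVl oN).
apply/esym/fN; exact: (tv_rep_idx t).
Qed.

Lemma wr_funM (w w' : W) g q : w.2 = tv_idx t g ->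
  wr_fun (w * w')%pg q = wr_fun w q + wr_fun w' (g^-1 * q)%pg.
Proof.
by move=> wg; rewrite /wr_fun [LHS]ffunE wg (tv_idxVl oN) tv_idxMr.
Qed.

Lemma wr_pair_continuous (f : G -> G -> C) :
  (forall g n, N n -> f (g * n)%pg = f g) ->
  continuous (fun g => wr_pair (f g) g).
Proof.
move=> fN g A nA.
apply: (@filterS _ _ _ [set y | N (g^-1 * y)%pg]); last first.
  apply: open_nbhs_nbhs; split; first exact: coset_open.
  by rewrite /= pg_mulVg; exact: onormal1.
move=> y /= Ny; suff -> : wr_pair (f y) y = wr_pair (f g) g by exact: nbhs_singleton nA.
have fE : f y = f g by rewrite -{1}(pg_mulVKg g y) fN.
by rewrite /wr_pair fE; congr pair; apply/esym/(tv_idxP t).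
Qed.

Lemma wr_pair_conv (f : X -> G -> C) :
  finite_set [set x | f x <> (fun _ => 0)] ->
  conv_to_one (fun x => wr_pair (f x) (iota x)).
Proof.
move=> fin U oU U1; apply: (@sub_finite_set _ _
   ([set x | f x <> (fun _ => 0)] `|` [set x | ~ N (iota x)])); last first.
  by rewrite finite_setU; split => //; apply: iota1; [case: oN|exact: onormal1].
move=> x /= nU; apply: contrapT => /not_orP[/contrapT fx /contrapT Nx].
apply: nU; suff -> : wr_pair (f x) (iota x) = wr_one oN t C by [].
rewrite /wr_pair fx; congr pair.
by apply/esym/(tv_idxP t); rewrite !pgE.
Qed.

End FixN.

Local Open Scope ring_scope.

(** Let [f] be the indicator function of the union of the cosets of [N] met by powers of [g]. The
    homomorphism to the wreath product twisted by the coboundary of [f] agrees with the untwisted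
    one on the generators, as [f] is invariant under [g]. By uniqueness they agree at [h], which
    gives [f h = f 1]. *)
Lemma free_generated (g : G) : (forall x, iota x = g) ->
  forall h (N : set G), onormal N -> H h -> exists n, N ((pw g n)^-1 * h)%pg.
Proof.
move=> iotag h N oN Hh; case: (proG) => pp _.
have [t [k tk]] := onormal_transversal oN.
have Cl : #|'F_p| = (p ^ 1)%N by rewrite card_Fp.
have proW := wreath_pro_p oN tk Cl.
pose f (q : G) : 'F_p := (`[< exists n, N ((pw g n)^-1 * q)%pg >])%:R.
have fN y y' : N (y^-1 * y')%pg -> f y = f y'.
  move=> Nyy; congr (_%:R); congr nat_of_bool.
  apply/asbool_equiv_eq; split=> -[n Ny]; exists n.
    by have := onormalM oN Ny Nyy; rewrite !pgE.
  by have := onormalM oN Ny (onormalV oN Nyy); rewrite !pgE.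
have fg q : f (g^-1 * q)%pg = f q.
  congr (_%:R); congr nat_of_bool.
  apply/asbool_equiv_eq; split=> -[n Nq]; first by exists n.+1; move: Nq; rewrite !pgE.
  case: n Nq => [|n] Nq; last by exists n; move: Nq; rewrite !pgE.
  (* For [n = 0] the inverse of [g] must be written as a natural power modulo [N]. *)
  have [[//|m] _ Nm] := pw_order g oN; exists m.
  by have := onormalM oN (onormalV oN Nm) Nq; rewrite !pgE.
have c0 := @wr_pair_conv N oN t _ (fun _ _ => 0 : 'F_p)
  ltac:(by rewrite (_ : mkset _ = set0); [exact: finite_set0|apply/seteqP; split]).
have [phi [_ _ _ uni]] := univ proW c0.
have e1 := uni (wr_pair oN t (fun _ => 0)).
pose F h q := f q - f (h^-1 * q)%pg.
have e2 := uni (fun h => wr_pair oN t (F h) h).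
have : wr_pair oN t (F h) h = wr_pair oN t (fun _ => 0) h.
  rewrite e1// ?e2//.
  - move=> x y Hx Hy; rewrite wr_pairM; last first.
      move=> z z' Nz; rewrite /F (fN _ _ Nz); congr (_ - _); apply: fN.
      by rewrite !pgE.
    by congr wr_pair; apply/funext => q; rewrite /F !pgE addrA subrK.
  - apply: continuous_subspaceT; apply: wr_pair_continuous => z n Nn.
    apply/funext => q; rewrite /F; congr (_ - _); apply: fN; rewrite !pgE.
    by have := onormalJV (z^-1 * q)%pg oN Nn; rewrite !pgE.
  - move=> x; rewrite iotag; congr wr_pair; apply/funext => q.
    by rewrite /F fg subrr.
  - by move=> x y Hx Hy; rewrite wr_pairM//; congr wr_pair; apply/funext => q; rewrite addr0.
  - by apply: continuous_subspaceT; exact: (@wr_pair_continuous N oN t _ (fun _ _ => 0)).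
move=> /(congr1 (fun w => wr_fun w h)).
rewrite (wr_fun_pair _ _ _ _ _)//; last first.
  move=> z z' Nz; rewrite /F (fN _ _ Nz); congr (_ - _); apply: fN.
  by rewrite !pgE.
rewrite (wr_fun_pair _ _ _ _ _)// /F pg_mulVg => /eqP; rewrite subr_eq0 => /eqP fh.
have f1 : f 1%pg = 1 by rewrite /f asboolT//; exists 0%N; rewrite !pgE; exact: onormal1.
by apply: contrapT => nh; move: fh; rewrite f1 {1}/f asboolF// => /esym/eqP.
Qed.

Lemma free_procyclic g : H g -> (forall x, iota x = g) -> procyclic_subgroup H.
Proof.
move=> Hg iotag; split=> //; exists g => //.
have [N0 oN0 N0H] := @onormal_base G H oH H1.
apply/seteqP; split=> h.
- move=> /(_ [set y | N0 (h^-1 * y)%pg])[].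
    apply: open_nbhs_nbhs; split; first exact: coset_open.
    by rewrite /= pg_mulVg; exact: onormal1.
  move=> _ [[n _ <-] /N0H Hn].
  have Hpw k : H (pw g k) by elim: k => //= k IH; exact: HM.
  have Hgn : H (gpowz g n) by case: n {Hn} => k; [exact: Hpw|apply: HV; exact: (Hpw k.+1)].
  by have := HM Hgn (HV Hn); rewrite !pgE.
- move=> Hh B; rewrite nbhsE => -[U [oU Uh] UB].
  have [N oN NU] := open_onormal_coset oU Uh.
  have [n Nn] := free_generated iotag oN Hh.
  exists (pw g n); split; first by exists (Posz n).
  by apply: UB; have := NU _ (onormalV oN Nn); rewrite !pgE.
Qed.

(* [d] is the Fox derivative with respect to the free generator [a], with values
   in the functions [G/N -> C]. *)
Definition fox_der (a : X) (N : set G) (C : finNzRingType) (d : G -> G -> C) :=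
  [/\ forall g h q, H g -> H h -> d (g * h)%pg q = d g q + d h (g^-1 * q)%pg,
      forall q, d (iota a) q = (`[< N q >])%:R,
      forall x q, x <> a -> d (iota x) q = 0,
      forall h q q', N (q^-1 * q')%pg -> d h q = d h q' &
      exists2 M, onormal M /\ M `<=` H `&` N &
        forall h m, H h -> M m -> d (h * m)%pg = d h].

(** A Magnus embedding: the universal property yields a homomorphism to the wreath product sending
    each generator [x] to the pair of [f x] and its class; [d] is its first component. *)
Lemma fox_derivative (a : X) (N : set G) (C : finNzRingType) (l : nat) :
  onormal N -> #|C| = (p ^ l)%N -> exists d : G -> G -> C, fox_der a N d.
Proof.
move=> oN Cl; have [t [k tk]] := onormal_transversal oN.
have proW := wreath_pro_p oN tk Cl.
pose f (x : X) (q : G) : C := if `[< x = a >] then (`[< N q >])%:R else 0.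
have fN x y y' : N (y^-1 * y')%pg -> f x y = f x y'.
  move=> Nyy; rewrite /f; case: ifP => // _; congr (_%:R); congr nat_of_bool.
  apply/asbool_equiv_eq; split=> [Ny|Ny'].
    by have := onormalM oN Ny Nyy; rewrite !pgE.
  by have := onormalM oN Ny' (onormalV oN Nyy); rewrite !pgE.
have fconv := @wr_pair_conv N oN t C f.
have {fconv} /fconv : finite_set [set x | f x <> (fun _ => 0)].
  apply: (@sub_finite_set _ _ [set a]); last exact: finite_set1.
  move=> x /=; apply: contra_notP => xa; apply/funext => q.
  by rewrite /f asboolF.
move=> /(univ proW)[phi [homphi cphi phiE _]].
(* By uniqueness the second component is the quotient map: both become homomorphisms to the wreath
   product with the same values on the generators. *)
have phi2 h : H h -> (phi h).2 = tv_idx t h.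
  have /(univ proW)[psi [_ _ _ uni]] := @wr_pair_conv N oN t C (fun _ _ => 0)
     ltac:(by rewrite (_ : mkset _ = set0); [exact: finite_set0|apply/seteqP; split]).
  pose r (w : wreath t C oN) : finite_ProfGroup (wreath t C oN) := (0, w.2).
  have e1 := uni (fun h => r (phi h)); have e2 := uni (fun h => wr_pair oN t (fun _ => 0) h).
  move=> Hh; have : r (phi h) = wr_pair oN t (fun _ => 0) h; last by case.
  rewrite e1//; first rewrite e2//.
  - by move=> x y Hx Hy; rewrite wr_pairM//; congr wr_pair; apply/funext => q; rewrite addr0.
  - by apply: continuous_subspaceT; exact: (@wr_pair_continuous N oN t C (fun _ _ => 0)).
  - move=> x y Hx Hy; rewrite /r homphi//; congr pair.
    by apply/ffunP => q; rewrite !ffunE addr0.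
  - move=> x; apply: continuous_comp; [exact: cphi|exact: discrete_continuous].
  - by move=> x; rewrite phiE; congr pair; apply/ffunP => q; rewrite !ffunE.
exists (fun h q => wr_fun (phi h) q); split.
- by move=> g h q Hg Hh; rewrite homphi// (wr_funM _ _ (phi2 _ Hg)).
- by move=> q; rewrite phiE (wr_fun_pair _ _ _ _ (fN _)) /f (asboolT (erefl a)).
- by move=> x q xa; rewrite phiE (wr_fun_pair _ _ _ _ (fN _)) /f (asboolF xa).
- by move=> h q q' /(tv_idxP t) e; rewrite /wr_fun e.
have phi1 : phi 1%pg = 1%pg.
  have := homphi _ _ H1 H1; rewrite pg_mul1g => e.
  by rewrite -(pg_mulKg (phi 1%pg) (phi 1%pg)) -e pg_mulVg.
(* The target is discrete, so continuity makes [phi] trivial near 1; this gives local constancy of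
   [d]. *)
have : nbhs (1%pg : G) [set h | H h -> phi h = 1%pg].
  have /subspace_continuousP/(_ _ H1 [set 1%pg]) := cphi.
  by apply; rewrite /from_subspace phi1; exact: (@discrete_set1 (discrete_group (wreath t C oN))).
rewrite nbhsE => -[U [oU U1] UH].
have [M oM MU] := @onormal_base G (U `&` (H `&` N))
  ltac:(by apply: openI => //; apply: openI => //; exact: (proj2 oN))
  (conj U1 (conj H1 (onormal1 oN))).
exists M; first by split=> // m /MU[].
by move=> h m Hh /MU[Um [Hm _]]; rewrite homphi// (UH m)// pg_mulg1.
Qed.

(** * Fox calculus on the free subgroup *)

Section FoxCalculus.
Variables (a : X) (N : set G) (oN : onormal N) (C : finNzRingType) (d : G -> G -> C).
Hypothesis fd : fox_der a N d.

Lemma H_pw h n : H h -> H (pw h n).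
Proof. by move=> Hh; elim: n => //= n IH; exact: HM. Qed.

Lemma foxM g h q : H g -> H h -> d (g * h)%pg q = d g q + d h (g^-1 * q)%pg.
Proof. by case: fd => fM _ _ _ _; exact: fM. Qed.

Lemma fox1 q : d 1%pg q = 0.
Proof.
have := foxM q H1 H1; rewrite !pgE => /eqP.
by rewrite -subr_eq0 opprD addrA subrr sub0r oppr_eq0 => /eqP.
Qed.

Lemma foxV h q : H h -> d h^-1%pg q = - d h (h * q)%pg.
Proof.
move=> Hh; have := foxM (h * q)%pg Hh (HV Hh); rewrite !pgE fox1 => /eqP.
by rewrite eq_sym addrC addr_eq0 => /eqP.
Qed.

Lemma fox_N h q q' : N (q^-1 * q')%pg -> d h q = d h q'.
Proof. by case: fd => _ _ _ fN _; exact: fN. Qed.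

(** For [u] in [N] the contributions of [h] and its inverse cancel, since derivatives are functions
    on G/N. *)
Lemma foxJ h u q : H h -> H u -> N u -> d (h * (u * h^-1))%pg q = d u (h^-1 * q)%pg.
Proof.
move=> Hh Hu Nu; rewrite !foxM//; try exact: HV; try (apply: HM => //; exact: HV).
rewrite foxV//.
have -> : d h (h * (u^-1 * (h^-1 * q)))%pg = d h q.
  apply: fox_N; have := onormalJV (h^-1 * q)%pg oN Nu; rewrite !pgE.
  by move=> N'; rewrite ?pgE.
by rewrite addrC subrK.
Qed.

Lemma foxM_N u v q : H u -> N u -> H v -> d (u * v)%pg q = d u q + d v q.
Proof.
move=> Hu Nu Hv; rewrite foxM//; congr (_ + _); apply: fox_N.
by have := onormalJV q oN Nu; rewrite !pgE.
Qed.

Lemma fox_pw n q :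
  d (pw (iota a) n) q = \sum_(k < n) (`[< N ((pw (iota a) k)^-1 * q)%pg >])%:R.
Proof.
elim: n => [|n IH]; first by rewrite big_ord0 fox1.
rewrite pwSr (foxM _ (H_pw n (Hiota a)) (Hiota a)) IH big_ord_recr; congr (_ + _).
by case: fd => _ ->.
Qed.

Lemma fox_pw0 b n q : b <> a -> d (pw (iota b) n) q = 0.
Proof.
move=> ba; elim: n => [|n IH]; first by rewrite fox1.
by rewrite pwSr (foxM _ (H_pw n (Hiota b)) (Hiota b)) IH add0r; case: fd => _ _ ->.
Qed.

(** Compare the product rule for a^n a and for a a^n: the indicator functions of [N] and of a^n N
    coincide. *)
Lemma fox_pw_eq0 n : (forall q, d (pw (iota a) n) q = 0) -> N (pw (iota a) n).
Proof.
move=> d0.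
have e q : (`[< N q >])%:R = (`[< N ((pw (iota a) n)^-1 * q)%pg >])%:R :> C.
  have /(congr1 (fun g => d g q)) := pwSr (iota a) n.
  have Hn := H_pw n (Hiota a).
  rewrite (foxM _ Hn (Hiota a)) d0 add0r (foxM _ (Hiota a) Hn) d0 addr0.
  by case: fd => _ fa _ _ _; rewrite !fa.
apply: contrapT => nN; have := e 1%pg; rewrite asboolT; last exact: onormal1.
rewrite asboolF ?pg_mulg1; last by move=> /(onormalVr oN).
by move/eqP; rewrite oner_eq0.
Qed.

Lemma fox_pw_support n q : d (pw (iota a) n) q != 0 ->
  exists k, N ((pw (iota a) k)^-1 * q)%pg.
Proof.
rewrite fox_pw; apply: contraNP => nk; rewrite big1// => k _.
by rewrite asboolF// => Nk; apply: nk; exists k.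
Qed.

Lemma fox_locally_constant :
  exists2 M, onormal M /\ M `<=` N & forall h m, H h -> M m -> d (h * m)%pg = d h.
Proof. by case: fd => _ _ _ _ [M [oM MH] dM]; exists M => //; split => // m /MH[]. Qed.

End FoxCalculus.

(** * Closures of the powers of a free generator *)

Lemma fox_exists a (N : set G) : onormal N -> exists d : G -> G -> 'F_p, fox_der a N d.
Proof. by move=> oN; apply: (@fox_derivative _ _ _ 1%N) => //; rewrite card_Fp//; case: proG. Qed.

(** Membership of [z] in the closed subgroup generated by [g]; natural exponents suffice because [g]
    has finite order modulo each [N] when [G] is pro-p. *)
Definition in_powers (g z : G) :=
  forall N, onormal N -> exists n, N ((pw g n)^-1 * z)%pg.

Lemma in_powers_pw g n : in_powers g (pw g n).
Proof. by move=> N oN; exists n; rewrite pg_mulVg; exact: onormal1. Qed.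

(** For [N = G] the derivative is a homomorphism from [H] to Z/p^(n+1) with value n at b^n, and the
    modulus exceeds n. *)
Lemma pw_iota_neq1 b n : (0 < n)%N -> pw (iota b) n <> 1%pg.
Proof.
move=> n0 e; case: (proG) => pp _.
have n2 : (1 < p ^ n.+1)%N by rewrite -(expn0 p) ltn_exp2l ?prime_gt1.
have [|d fd] := @fox_derivative b setT 'Z_(p ^ n.+1) n.+1 (onormalT G).
  by rewrite card_ord Zp_cast.
have := fox_pw fd n 1%pg; rewrite e (fox1 fd).
under eq_bigr do rewrite asboolT//.
rewrite sumr_const card_ord => /(congr1 val)/=/esym.
rewrite val_Zp_nat// modn_small => [e0|]; first by rewrite e0 in n0.
by rewrite (leq_trans (ltn_expl n (prime_gt1 pp)))// leq_exp2l ?prime_gt1.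
Qed.

Variables (a b : X).
Hypothesis ab : a <> b.

(** The derivative of [z] with respect to [a] is that of a power of [a] and that of a power of [b];
    the latter vanishes, so [fox_pw_eq0] applies. *)
Lemma in_powersI z : in_powers (iota a) z -> in_powers (iota b) z -> z = 1%pg.
Proof.
move=> az bz; apply: contrapT => /onormal_separate[N oN Nz].
have [d fd] := fox_exists a oN.
have [M [oM MN] dM] := fox_locally_constant fd.
have [i Mi] := az _ oM; have [j Mj] := bz _ oM.
have di : d (pw (iota a) i) = d z by rewrite -(dM _ _ (H_pw i (Hiota a)) Mi) pg_mulVKg.
have dj : d (pw (iota b) j) = d z by rewrite -(dM _ _ (H_pw j (Hiota b)) Mj) pg_mulVKg.
apply: Nz; have Ni : N (pw (iota a) i).
  by apply: (fox_pw_eq0 oN fd) => q; rewrite di -dj (fox_pw0 fd)//; exact: nesym.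
by have := onormalM oN Ni (MN _ Mi); rewrite pg_mulVKg.
Qed.

(* The derivatives of [z] and [b^-n z b^n] have disjoint supports, because [b^n] is
   not in the closure of the powers of [a]. *)
Lemma in_powersJ n z : (0 < n)%N -> in_powers (iota a) z ->
  in_powers (iota a) ((pw (iota b) n)^-1 * (z * pw (iota b) n))%pg -> z = 1%pg.
Proof.
move=> n0; set B := pw (iota b) n => az bz.
have HB : H B by exact: H_pw.
have : ~ in_powers (iota a) B.
  by move=> aB; apply: (@pw_iota_neq1 b n n0); exact: (in_powersI aB (@in_powers_pw _ n)).
move=> /existsNP[N1 /not_implyP[oN1 nB]].
apply: contrapT => /onormal_separate[N0 oN0 N0z].
pose N := N0 `&` N1; have oN : onormal N by exact: onormalI.
have [d fd] := fox_exists a oN.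
have [M [oM MN] dM] := fox_locally_constant fd.
have [i Mi] := az _ oM; have [j Mj] := bz _ oM.
have Ha k : H (pw (iota a) k) by exact: H_pw.
have di : d (pw (iota a) i) = d z by rewrite -(dM _ _ (Ha i) Mi) pg_mulVKg.
set x := (B^-1 * (z * B))%pg in bz Mj *.
have dj : d (pw (iota a) j) = d x by rewrite -(dM _ _ (Ha j) Mj) pg_mulVKg.
have zx : z = (B * (x * B^-1))%pg by rewrite /x !pgE.
have dB q : d B q = 0 by apply: (fox_pw0 fd); exact: nesym.
(* As [B] has zero derivative, conjugating by [B] translates the derivative. *)
have dzq q : d z q = d x (B^-1 * q)%pg.
  pose x' := pw (iota a) j.
  have -> : z = ((B * (x' * B^-1)) * (B * (((pw (iota a) j)^-1 * x) * B^-1)))%pg.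
    by rewrite /x' zx !pgE.
  have Hx' : H x' := Ha j; have HB' : H (B^-1)%pg := HV HB.
  rewrite (dM _ _ (HM HB (HM Hx' HB')) (onormalJ B oM Mj)).
  rewrite (foxM fd _ HB (HM Hx' HB')) dB add0r (foxM fd _ Hx' HB').
  by rewrite (foxV fd)// dB oppr0 addr0 dj.
(* A common point of the two supports lies in a^k N and in B a^l N, which would put [B] in a^k a^-l
   N. *)
apply: N0z; have Ni : N (pw (iota a) i).
  apply: (fox_pw_eq0 oN fd) => q; apply/eqP; apply: contrapT => /negP dq.
  have [k Nk] := fox_pw_support fd dq.
  move: dq; rewrite di dzq -dj => /(fox_pw_support fd)[l Nl].
  apply: nB; have [m Nm] := pwV (iota a) l oN.
  exists (k + m)%N.
  have [_] := onormalM oN (onormalJV (pw (iota a) m) oN (onormalM oN Nk (onormalV oN Nl)))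
    (onormalV oN Nm).
  by rewrite pwD !pgE.
have [+ _] := onormalM oN Ni (MN _ Mi).
by rewrite pg_mulVKg.
Qed.

(** Otherwise [s0] and s0 b^n, with n > 0 and b^n close to 1, would both conjugate [g] into the
    closure of the powers of [a], against [in_powersJ]. *)
Lemma in_powersJ_interior (g : G) (O : set G) : g <> 1%pg -> open O -> O !=set0 ->
  exists2 s, O s & ~ in_powers (iota a) (s^-1 * (g * s))%pg.
Proof.
move=> g1 oO [s0 Os0]; apply: contrapT => nO.
have {}nO s : O s -> in_powers (iota a) (s^-1 * (g * s))%pg.
  by move=> Os; apply: contrapT => ?; apply: nO; exists s.
have [N oN NO] := open_onormal_coset oO Os0.
have [n n0 Nn] := pw_order (iota b) oN.
have := in_powersJ n0 (nO _ Os0); have := nO _ (NO _ Nn).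
rewrite !pgE => h /(_ h) e; apply: g1.
have : (s0 * ((s0^-1 * (g * s0)) * s0^-1))%pg = 1%pg by rewrite e !pgE.
by rewrite !pgE.
Qed.

Lemma closed_in_powersJ (c g : G) : closed [set s | in_powers c (s^-1 * (g * s))%pg].
Proof.
rewrite -openC openE => s /= /existsNP[N /not_implyP[oN nN]].
apply: (@filterS _ _ _ [set y | N (s^-1 * y)%pg]); last first.
  apply: open_nbhs_nbhs; split; first exact: coset_open.
  by rewrite /= pg_mulVg; exact: onormal1.
move=> y /= Ny; apply/existsNP; exists N; apply/not_implyP; split => //.
move=> [n Nn]; apply: nN; exists n.
have N1 := onormalM oN Nn (onormalV oN Ny).
by have := onormalM oN (onormalJV (pw c n) oN Ny) N1; rewrite !pgE.
Qed.

(** Take for [m] the order of [a] modulo [N]: among the cosets a^k N with k < m, only that of k = 0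
    contains 1. *)
Lemma pw_min_order (N : set G) (d : G -> G -> 'F_p) : onormal N ->
  fox_der a N d -> exists2 m, N (pw (iota a) m) & d (pw (iota a) m) 1%pg = 1.
Proof.
move=> oN fd; have [m0 m00 Nm0] := pw_order (iota a) oN.
have ex : exists m, (0 < m)%N && `[< N (pw (iota a) m) >].
  by exists m0; rewrite m00; apply/asboolP.
case: (ex_minnP ex) => -[//|m] /andP[_ /asboolP Nm] min.
exists m.+1 => //; rewrite (fox_pw fd) big_ord_recl big1 => [|k _].
  by rewrite addr0 asboolT// !pgE; exact: onormal1.
rewrite asboolF// pg_mulg1 => /(onormalVr oN) Nk.
have := min (lift ord0 k); rewrite lift0 /= asboolT// => /(_ isT).
by rewrite ltnNge ltn_ord.
Qed.

(** * Elements with open centraliser *)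

Lemma onormal_in_H : exists2 N, onormal N & N `<=` H.
Proof. exact: onormal_base. Qed.

(** If [h] commutes with u = s a^m s^-1, the derivative of [u] is invariant under translation by
    [h]. It is 1 at [s], hence at h^-1 s, which puts s^-1 h^-1 s in some a^k N; a generic [s]
    prevents this. *)
Lemma H_vcent h : H h -> vcent h -> h = 1%pg.
Proof.
move=> Hh [N2 oN2 cN2]; apply: contrapT => h1.
have hV1 : (h^-1)%pg <> 1%pg by move=> e; apply: h1; rewrite -(pg_invgK h) e pg_inv1.
have [|s Hs] := in_powersJ_interior hV1 oH; first by exists 1%pg.
move=> /existsNP[N1 /not_implyP[oN1 nN1]].
have [N3 oN3 N3H] := onormal_in_H.
pose N := N1 `&` (N2 `&` N3); have oN : onormal N by do 2!apply: onormalI => //.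
have [d fd] := fox_exists a oN; have [m Nm dm] := pw_min_order oN fd.
pose u := (s * (pw (iota a) m * s^-1))%pg.
have Nu : N u by exact: onormalJ.
have Hu : H u by case: Nu => _ [_ /N3H].
have Ha : H (pw (iota a) m) by exact: H_pw.
have hu : (h * (u * h^-1))%pg = u.
  by rewrite pg_mulA cN2 ?pgE//; case: Nu => _ [].
have := foxJ oN fd s Hh Hu Nu; rewrite hu /u !(foxJ oN fd)// !pgE dm => /esym e1.
have /(fox_pw_support fd)[k [N1k _]] :
    d (pw (iota a) m) (s^-1 * (h^-1 * s))%pg != 0.
  by rewrite e1 oner_eq0.
by apply: nN1; exists k.
Qed.

(** By [H_vcent], a coset of an open normal subgroup inside [H] contains at most one such element;
    removing it leaves a neighbourhood of [g]. *)
Lemma vcent_closed : closed [set g : G | vcent g].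
Proof.
rewrite -openC openE => g /= ng.
have [N oN NH] := onormal_in_H.
have nbN : nbhs g [set y | N (g^-1 * y)%pg].
  apply: open_nbhs_nbhs; split; first exact: coset_open.
  by rewrite /= pg_mulVg; exact: onormal1.
have [[k [Nk vk]]|nk] := pselect (exists k, N (g^-1 * k)%pg /\ vcent k); last first.
  by apply: filterS nbN => y Ny vy; apply: nk; exists y.
have nbk : nbhs g (~` [set k]).
  apply: open_nbhs_nbhs; split; last by move=> /= gk; apply: ng; rewrite gk.
  apply: closed_openC; apply: accessible_closed_set1; apply: hausdorff_accessible.
  exact: pg_hausdorff.
apply: filterS (filterI nbN nbk) => y [/= Ny yk] vy; apply: yk.
apply: pg_eq_mulVg1; apply: H_vcent; last by apply: vcentM => //; exact: vcentV.
by have := onormalM oN (onormalV oN Ny) Nk; rewrite !pgE => /NH.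
Qed.

(** Comparing [y0] with y0 n, for [n] near 1, puts the commutator of [n] with the conjugate of [g]
    by [y0] in K; it also lies in [H], so it is trivial and [g] is in K. *)
Lemma vcentJ_interior (g x x' : G) (O : set G) : ~ vcent g -> open O -> O !=set0 ->
  exists2 y, O y & ~ vcent (x * (y^-1 * (g * (y * x'))))%pg.
Proof.
move=> ng oO [y0 Oy0]; apply: contrapT => nO.
have {}nO y : O y -> vcent (x * (y^-1 * (g * (y * x'))))%pg.
  by move=> Oy; apply: contrapT => ?; apply: nO; exists y.
have [N0 oN0 NO] := open_onormal_coset oO Oy0.
have [N3 oN3 N3H] := onormal_in_H.
apply: ng; apply: (@vcentJV _ y0); exists (N0 `&` N3); first exact: onormalI.
set g' := (y0^-1 * (g * y0))%pg.
move=> n [Nn N3n].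
have v := vcentM (vcentV (nO _ Oy0)) (nO _ (NO _ Nn)).
have {v} : vcent (x'^-1 * ((g'^-1 * (n^-1 * (g' * n))) * x'))%pg.
  by move: v; rewrite /g' !pgE.
move=> /vcentJV v; apply/esym/pg_eq_mulVg1; rewrite pg_invMg pg_mulgAr.
apply: H_vcent => //; apply: N3H; rewrite (pg_mulA (n^-1)%pg) (pg_mulA (g'^-1)%pg).
by apply: onormalM => //; apply: onormalJV => //; exact: onormalV.
Qed.

(** * Robust non-triviality of the action *)

(** The character is the derivative evaluated at t_i0 s, tested on u = s a^m s^-1. The term of [i]
    is then the derivative of a^m at s^-1 t_i^-1 t_i0 s: it is 1 for [i0], and 0 for the others by
    the generic choice of [s]. *)
Lemma robust_base (I : finType) (P : pred I) (c : I -> 'F_p) (t : I -> G) i0 :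
  (forall i, P i -> H (t i)) -> (forall i j, P i -> P j -> t i = t j -> i = j) ->
  (forall i, P i -> c i != 0) -> P i0 -> robust P c t.
Proof.
move=> Ht injt c0 Pi0.
pose r := [seq i <- enum I | P i && (i != i0)].
pose gg i := ((t i)^-1 * t i0)%pg.
have [||s Hs hs] := @avoid_closed G I r
    (fun i => [set s | in_powers (iota a) (s^-1 * (gg i * s))%pg]) H oH.
- by exists 1%pg.
- move=> i; rewrite mem_filter => /andP[/andP[Pi ii0] _]; split.
    exact: closed_in_powersJ.
  move=> O oO O0 _; apply: in_powersJ_interior => // /pg_eq_mulVg1 /injt e.
  by move/eqP: ii0; apply; exact: e.
pose Q i (N : set G) := forall n, ~ N ((pw (iota a) n)^-1 * (s^-1 * (gg i * s)))%pg.
have [V0 oV0 QV0] : exists2 V, onormal V & forall i, i \in r -> Q i V.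
  apply: onormal_all => [i N M MN QN n /MN|i /hs]; first exact: QN.
  move=> /existsNP[N /not_implyP[oN nN]]; exists N => // n Nn; apply: nN; by exists n.
have [N3 oN3 N3H] := onormal_in_H.
exists (V0 `&` N3); first exact: onormalI.
move=> t' tt' N oN NV kN.
have NH : N `<=` H by move=> n /NV[_ /N3H].
have Ht' i : P i -> H (t' i).
  by move=> Pi; have := HM (Ht i Pi) (N3H _ (proj2 (tt' i Pi))); rewrite !pgE.
have [d fd] := fox_exists a oN; have [m Nm dm] := pw_min_order oN fd.
pose u := (s * (pw (iota a) m * s^-1))%pg.
have Nu : N u by exact: onormalJ.
have Ha : H (pw (iota a) m) by exact: H_pw.
have := kN (fun v => d v (t' i0 * s)%pg) _ u Nu.
have dJ i : P i -> d (t' i * (u * (t' i)^-1))%pg (t' i0 * s)%pg =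
    d (pw (iota a) m) (s^-1 * ((t' i)^-1 * (t' i0 * s)))%pg.
  move=> Pi; rewrite (foxJ oN fd _ (Ht' _ Pi) (NH _ Nu) Nu).
  by rewrite (foxJ oN fd _ Hs Ha Nm).
have add v w : N v -> N w ->
    d (v * w)%pg (t' i0 * s)%pg = d v (t' i0 * s)%pg + d w (t' i0 * s)%pg.
  by move=> Nv Nw; rewrite (foxM_N oN fd _ (NH _ Nv) Nv (NH _ Nw)).
move=> /(_ add); rewrite (bigD1 i0)//= dJ// !pgE dm mulr1 big1 => [/eqP|].
  by rewrite addr0; apply/negP; exact: c0.
move=> i /andP[Pi ii0]; rewrite dJ//; apply/eqP; rewrite mulf_eq0; apply/orP; right.
apply: contrapT => /negP /(fox_pw_support fd)[k Nk].
apply: (QV0 i _ k); first by rewrite mem_filter Pi ii0 mem_enum.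
have [V1 _] := NV _ Nk.
have [W1 _] := tt' _ Pi; have [W2 _] := tt' _ Pi0.
have W1' := onormalJV s oV0 W1; have W2' := onormalJV s oV0 W2.
have := onormalM oV0 (onormalM oV0 (onormalJV (pw (iota a) k) oV0 W1') V1) (onormalV oV0 W2').
by rewrite /gg !pgE.
Qed.

Lemma robust_distinct (I : finType) (P : pred I) (c : I -> 'F_p) (t : I -> G) i0 :
  (forall i j, P i -> P j -> i != j -> ~ vcent ((t i)^-1 * t j)%pg) ->
  (forall i, P i -> c i != 0) -> P i0 -> robust P c t.
Proof.
have [H0 oH0 H0H] := onormal_in_H.
have [tv _] := onormal_transversal oH0.
pose cosets (I : finType) (P : pred I) (t : I -> G) :=
  [pred q | [exists i, P i && (tv_idx tv (t i) == q)]].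
have [n] := ubnP #|cosets I P t|.
elim: n I P c t i0 => // n IH I P c t i0 card_n dist c0 Pi0.
pose P1 i := tv_idx tv (t i) == tv_idx tv (t i0).
have [[j0 /andP[Pj0 nP1j0]]|nP1] := pselect (exists j, P j && ~~ P1 j); last first.
  (* All elements lie in one coset; a right translation moves them into [H0]. *)
  apply: (@robust_shift _ _ _ _ _ _ (t i0)^-1%pg).
  apply: (robust_base (i0 := i0)) => //.
  - move=> i Pi; apply: H0H; have /eqP : P1 i.
      by apply: contrapT => /negP ni; apply: nP1; exists i; rewrite Pi ni.
    move=> /esym/(tv_idxP tv) h; exact: onormalC h.
  - move=> i j Pi Pj e; apply/eqP; apply: contrapT => /negP ij; apply: (dist i j Pi Pj ij).
    have -> : t i = t j.
      by have := congr1 (fun z => z * t i0)%pg e; rewrite !pgE.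
    by rewrite pg_mulVg; exact: vcent1.
pose J := (bool * (I * I))%type.
pose P' := elim_pred P P1.
pose L (k : J) := t (elim_left k); pose R (k : J) := t (elim_right k).
(* For [y] in [O], multiplication by t_i y or y t_i with [i] in [P1] preserves cosets of [H0], so
   the new support meets only the cosets of the [t j] outside [P1], and no longer that of [t i0]. *)
pose O := [set y : G | H0 (t i0 * y)%pg].
have oO : open O by have := coset_open (t i0)^-1%pg oH0; rewrite pg_invgK.
have O0 : O !=set0 by exists (t i0)^-1%pg; rewrite /O /= pg_mulgV; exact: onormal1.
pose r := [seq kk <- enum {: J * J} | [&& P' kk.1, P' kk.2 & elim_left kk.1 != elim_left kk.2]].
have PP k : P' k -> P (elim_left k) /\ P (elim_right k).
  by case: k => -[] [i j] /andP[/= /andP[? ?] /andP[? ?]].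
(* A generic [y] keeps products with different left factors distinct modulo K; products with equal
   left factors differ in the right one, where [dist] applies. *)
have [|y Oy hy] := @avoid_closed G _ r (fun kk => [set y | vcent
    ((R kk.1)^-1 * (y^-1 * (((L kk.1)^-1 * L kk.2) * (y * R kk.2))))%pg]) O oO O0.
  move=> [k k'] /=; rewrite mem_filter /= => /andP[/and3P[Pk Pk' kk'] _]; split.
    apply: (@closed_comp _ _ _ [set g : G | vcent g]); last exact: vcent_closed.
    move=> z _; move: z.
    do 2?[apply: pg_mul_continuous; first exact: cst_continuous].
    apply: pg_mul_continuous; first by apply: pg_inv_continuous => ?; exact: cvg_id.
    apply: pg_mul_continuous; first exact: cst_continuous.
    by apply: pg_mul_continuous => ?; [exact: cvg_id|exact: cst_continuous].
  move=> O' oO' O'0 _; apply: vcentJ_interior => //.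
  by apply: dist => //; [case: (PP _ Pk)|case: (PP _ Pk')].
apply: (@robust_elim _ _ _ _ P1 _ _ y).
apply: (IH _ _ _ _ (false, (i0, j0))).
- rewrite -ltnS; apply: leq_trans card_n; rewrite ltnS; apply: proper_card.
  have idx_elt k : P' k -> tv_idx tv (elim_elt t y k) = tv_idx tv (t k.2.2).
    case: k => s [i j] /andP[/= /andP[Pi P1i] /andP[Pj _]].
    have yi : H0 (t i * y)%pg.
      have /eqP/esym/(tv_idxP tv)/(onormalC oH0) h := P1i.
      by have := onormalM oH0 h Oy; rewrite !pgE.
    apply/esym/(tv_idxP tv); case: s; rewrite /elim_elt /=.
      by rewrite pg_mulKg; exact: onormalC.
    by have := onormalJV (t j) oH0 yi; rewrite !pgE.
  apply/properP; split.
    apply/fintype.subsetP => q; rewrite !inE => /existsP[k /andP[Pk /eqP <-]].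
    apply/existsP; exists k.2.2; rewrite idx_elt// eqxx andbT.
    by case/andP: Pk => _ /andP[].
  exists (tv_idx tv (t i0)); first by rewrite inE; apply/existsP; exists i0; rewrite Pi0 eqxx.
  rewrite inE; apply/existsPn => k; rewrite negb_and -implybE; apply/implyP => Pk.
  by rewrite idx_elt//; case/andP: Pk => _ /andP[].
- move=> k k' Pk Pk' kk'.
  have [e|ne] := eqVneq (elim_left k) (elim_left k'); last first.
    have kr : (k, k') \in r by rewrite mem_filter mem_enum andbT; apply/and3P; split.
    by have := hy _ kr; rewrite /= /L /R /elim_elt !pgE.
  have [[Pl Pr] [Pl' Pr']] := (PP _ Pk, PP _ Pk').
  have nr : elim_right k != elim_right k'.
    apply: contra kk' => /eqP er; move: e er Pk Pk'.
    rewrite /P' /elim_pred /elim_left /elim_right.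
    case: k k' {Pl Pr Pl' Pr'} => -[] [i j] [[] [i' j']] /= -> -> //;
      by move=> /andP[_ /andP[_ /negP nP]] /andP[/andP[_ /nP]].
  by have := dist _ _ Pr Pr' nr; rewrite /elim_elt e !pgE.
- move=> k /andP[/andP[Pi _] /andP[Pj _]].
  by rewrite /elim_coef !mulf_neq0// ?c0// expf_neq0// oppr_eq0 oner_eq0.
- by rewrite /elim_pred /= Pi0 Pj0 nP1j0 /P1 eqxx.
Qed.

(** * Measure of the set where a word takes values in K *)

Section Measure.
Variables (r : nat) (R : realType).
Local Notation GR := {ptws 'I_r -> G}.
Variable mu : {measure set (borelType GR) -> \bar R}.
Hypothesis haar : normalised_haar (@pow_mul G r) mu.

Definition word_vcent (w : word r) := [set g : GR | vcent (eval_word w g)].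

Lemma word_vcent_closed w : closed (word_vcent w).
Proof.
apply: (@closed_comp _ _ _ [set g : G | vcent g]); last exact: vcent_closed.
by move=> z _; exact: eval_word_continuous.
Qed.

Lemma subword_vcent (w : word r) (g : 'I_r -> G) m n : (m <= n)%N ->
  vcent ((eval_word (take m w) g)^-1 * eval_word (take n w) g)%pg ->
  vcent (eval_word (take (n - m) (drop m w)) g).
Proof.
move=> mn; have -> : take n w = take m w ++ take (n - m) (drop m w).
  by rewrite -[in LHS](subnKC mn) takeD.
by rewrite eval_word_cat pg_mulKg.
Qed.

(** The quotient of two prefixes is the value of a subword. That subword is empty only if two
    adjacent letters cancel, and the whole word only if the first letter cancels the last; the first
    two hypotheses exclude these. *)
Lemma prefix_at_distinct (w : word r) (g : GR) : reduced w ->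
  (forall (y : 'I_r * bool), nth y w 0 = y -> ~~ letter_cancel y (last y w)) ->
  (forall m n, (m < n <= size w)%N -> (n - m < size w)%N ->
    ~ vcent (eval_word (take (n - m) (drop m w)) g)) ->
  forall i j : 'I_(size w), (tnth (in_tuple w) i).1 = (tnth (in_tuple w) j).1 -> i != j ->
    ~ vcent ((prefix_at g i)^-1 * prefix_at g j)%pg.
Proof.
move=> redw cycw nsub.
have lt (i j : 'I_(size w)) : (tnth (in_tuple w) i).1 = (tnth (in_tuple w) j).1 -> (i < j)%N ->
    ~ vcent ((prefix_at g i)^-1 * prefix_at g j)%pg.
  have y := tnth (in_tuple w) i.
  rewrite /prefix_at !(tnth_nth y) /=.
  set si := nth y w i; set sj := nth y w j => eij ij.
  have le_ij : (i + si.2 <= j + sj.2)%N.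
    by case: si.2; case: sj.2 => /=; rewrite ?addn0 ?addn1 //; lia.
  have lt_ij : (i + si.2 < j + sj.2)%N.
    rewrite ltn_neqAle le_ij andbT; apply/eqP => e.
    have [sit sjf] : si.2 = true /\ sj.2 = false.
      by move: e; case: si.2; case: sj.2 => //=; rewrite ?addn0 ?addn1 => *; split => //; lia.
    have ji : (j = i.+1 :> nat)%N by move: e; rewrite sit sjf /=; lia.
    have := redw; rewrite reducedE => /(sortedP y)/(_ i).
    rewrite -ji ltn_ord => /(_ isT); rewrite -/si -/sj /letter_cancel eij eqxx sit sjf.
    by [].
  have sjw : (j + sj.2 <= size w)%N.
    by have := ltn_ord j; case: sj.2 => /=; rewrite ?addn0 ?addn1 //; lia.
  move=> /(subword_vcent le_ij); apply: nsub; first by rewrite lt_ij.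
  rewrite ltn_neqAle; apply/andP; split; last by lia.
  apply/eqP => e.
  have [i0 jl] : (i + si.2 = 0 /\ j + sj.2 = size w)%N by lia.
  have sif : si.2 = false by move: i0; case: si.2 => //=; lia.
  have i00 : (i = 0 :> nat)%N by move: i0; rewrite sif /=; lia.
  have sjt : sj.2 = true.
    by have := ltn_ord j; move: jl; case: sj.2 => //=; lia.
  have := cycw si; rewrite -nth_last (set_nth_default y); last by have := ltn_ord i; lia.
  have -> : (size w).-1 = j by move: jl; rewrite sjt /=; lia.
  rewrite (set_nth_default y); last exact: ltn_ord.
  rewrite -/sj {1}/si i00 => /(_ erefl).
  by rewrite /letter_cancel eij eqxx sif sjt.
move=> i j eij ij; have [ij'|ji|e] := ltngtP i j; first exact: lt.
- move=> /vcentV; rewrite !pgE; exact: lt.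
- by move/eqP: ij; case; exact: ord_inj.
Qed.

Local Open Scope ereal_scope.

(** The additive map [L] vanishes on the displacements from [g] to points of [T], but not on [v]. So
    [T] and its translate by [v] are disjoint subsets of [C] of equal measure. *)
Lemma coset_half (N : set G) (tv : transversal_of N) (S : set GR) (w : word r) i0 (g : GR) :
  onormal N -> N `<=` H -> closed S -> S `<=` word_vcent w -> S g ->
  ~ kills N (fun j => (tnth (in_tuple w) j).1 == i0)
      (fun j => ((-1) ^+ (tnth (in_tuple w) j).2)%R : 'F_p) (prefix_at g) ->
  mu (S `&` [set h | coset_index tv h = coset_index tv g]) +
  mu (S `&` [set h | coset_index tv h = coset_index tv g]) <=
  mu [set h | coset_index tv h = coset_index tv g].
Proof.
move=> oN NH cS Sw Sg nk.
set C := [set h | _]; set T := S `&` C.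
have [chi [chiM [v0 [Nv0 nv0]]]] : exists chi : G -> 'F_p,
    (forall u v, N u -> N v -> chi (u * v)%pg = (chi u + chi v)%R) /\
    exists v0, N v0 /\ (\sum_(j | (tnth (in_tuple w) j).1 == i0)
      (-1) ^+ (tnth (in_tuple w) j).2 *
      chi (prefix_at g j * (v0 * (prefix_at g j)^-1))%pg)%R <> 0%R.
  apply: contrapT => nchi; apply: nk => chi chiM u Nu; apply: contrapT => nu.
  by apply: nchi; exists chi; split => //; exists u.
pose L (u : 'I_r -> G) := (\sum_(j < size w) (-1) ^+ (tnth (in_tuple w) j).2 *
  chi (prefix_at g j * (u (tnth (in_tuple w) j).1 * (prefix_at g j)^-1))%pg)%R.
have chi1 : chi 1%pg = 0%R.
  have := chiM 1%pg 1%pg (onormal1 oN) (onormal1 oN); rewrite pg_mul1g => /eqP.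
  by rewrite -subr_eq0 opprD addrA subrr sub0r oppr_eq0 => /eqP.
(* Both word values are in K, and their quotient lies in [N], hence in [H]; so it is trivial. *)
have L0 (u : 'I_r -> G) : (forall i, N (u i)) -> S (twist u g) -> L u = 0%R.
  move=> Nu Su; rewrite /L -(eval_word_twist w g oN chiM Nu).
  suff -> : (eval_word w (twist u g) * (eval_word w g)^-1)%pg = 1%pg by [].
  apply: H_vcent; first by apply: NH; exact: eval_word_twist_onormal.
  by apply: vcentM; [exact: Sw|apply: vcentV; exact: Sw].
have LM (u v : 'I_r -> G) : (forall i, N (u i)) -> (forall i, N (v i)) ->
    L (fun i => v i * u i)%pg = (L v + L u)%R.
  move=> Nu Nv; rewrite /L -big_split; apply: eq_bigr => j _; rewrite /= -mulrDr; congr (_ * _)%R.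
  rewrite -chiM; [|exact: onormalJ|exact: onormalJ].
  by rewrite !pgE.
pose v : GR := fun i => if i == i0 then v0 else 1%pg.
have Nv i : N (v i) by rewrite /v; case: ifP => // _; exact: onormal1.
have Lv : L v <> 0%R.
  move=> Lv; apply: nv0; rewrite -[RHS]Lv /L [LHS]big_mkcond; apply: eq_bigr => j _.
  by rewrite /v; case: ifP => // _; rewrite !pgE chi1 mulr0.
have cT : closed T.
  apply: closedI => //.
  exact: (@coset_index_closed _ _ _ oN tv [set o | o = coset_index tv g]).
have [cvT mvTE] := haar_translate_closed haar v cT.
rewrite -[X in _ + X]mvTE.
have [mT mvT] := (closed_borel cT, closed_borel cvT).
rewrite -measureU//; last first.
  apply/seteqP; split=> // y [[Sy _] [x [Sx /esym/coset_indexP Cx] xy]].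
  pose u : 'I_r -> G := fun i => (x i * (g i)^-1)%pg.
  have Nu i : N (u i) by exact: (onormalC oN (Cx i)).
  have ux : twist u g = x by apply/funext => i; rewrite /twist /u !pgE.
  apply: Lv; have := LM u v Nu Nv; rewrite (L0 u Nu); last by rewrite ux.
  rewrite addr0 => <-; apply: L0; first by move=> i; exact: onormalM.
  rewrite (_ : twist _ g = y)// -xy; apply/funext => i.
  by rewrite /twist /u /pow_mul !pgE.
apply: haar_le; [exact: measurableU| |].
  by apply: open_borel; exact: (coset_index_open oN [set o | o = coset_index tv g]).
move=> y [[]//|[x [_ Cx] <-]]; rewrite /C /= -Cx; apply/(coset_indexP tv) => i.
have := onormalJV (x i) oN (onormalV oN (Nv i)).
by rewrite /pow_mul !pgE.
Qed.

Lemma word_vcent_null n (w : word r) : (size w <= n)%N -> reduced w -> w != [::] ->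
  mu (word_vcent w) = 0.
Proof.
elim: n w => [|n IH] w; first by rewrite leqn0 size_eq0 => ->.
move=> wn redw wN0.
(* If the first and last letters cancel, [w] is a conjugate of a shorter word and K is normal. *)
have [[y [y0 ycan]]|cycw] := pselect (exists y : 'I_r * bool, nth y w 0 = y /\
    letter_cancel y (last y w)).
  case: w y0 wn redw wN0 ycan => // x w xy.
  have {xy} -> : x = y by exact: xy.
  case: (lastP w) => [|v z] wn redw _ /=.
    by rewrite /letter_cancel !eqxx.
  rewrite last_rcons => /andP[/eqP yz1 yz2].
  have redv : reduced v.
    move: redw; rewrite !reducedE => /(drop_sorted 1)/(take_sorted (size v)).
    by rewrite /= drop0 -cats1 take_size_cat.
  have vN0 : v != [::].
    by apply: contraTneq redw => ->; rewrite /= yz1 eqxx yz2.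
  suff -> : word_vcent (y :: rcons v z) = word_vcent v.
    by apply: IH => //; move: wn; rewrite /= size_rcons; lia.
  have e g : vcent (eval_word (y :: rcons v z) g) <-> vcent (eval_word v g).
    rewrite -cat1s -cats1 !eval_word_cat; set Y := eval_word [:: y] g.
    have -> : eval_word [:: z] g = Y^-1%pg.
      by rewrite /Y /= yz1 !pgE; case: (y.2) (z.2) yz2 => -[]; rewrite ?pgE.
    split=> [|/(vcentJ (Y^-1)%pg)]; last by rewrite !pgE.
    by move=> h; apply: (@vcentJV _ (Y^-1)%pg); move: h; rewrite !pgE.
  by apply/seteqP; split=> g /e.
apply/eqP; rewrite eq_le measure_ge0 andbT leNgt; apply/negP => mpos.
have mS := closed_borel (@word_vcent_closed w).
have wsize : (0 < size w)%N by rewrite lt0n size_eq0.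
pose sub (mn : 'I_(size w).+1 * 'I_(size w).+1) : word r := take (mn.2 - mn.1) (drop mn.1 w).
pose s := [seq mn : 'I_(size w).+1 * 'I_(size w).+1 <- enum {: 'I_(size w).+1 * 'I_(size w).+1} |
  (mn.1 < mn.2)%N && (mn.2 - mn.1 < size w)%N].
have [|Z0 [cZ0 mZ0 sZ0]] := @closed_null_union G r R mu _ s (fun mn => word_vcent (sub mn)).
  move=> [k l]; rewrite mem_filter => /andP[/= /andP[kl klw] _].
  split; first exact: word_vcent_closed.
  have lw := ltn_ord l.
  have sz : size (sub (k, l)) = (l - k)%N.
    by rewrite /sub /= size_take size_drop; case: ltnP => //; lia.
  apply: IH; first by rewrite sz; lia.
    by rewrite reducedE; apply: take_sorted; apply: drop_sorted; rewrite -reducedE.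
  by rewrite -size_eq0 sz; lia.
have mZ := closed_borel cZ0.
(* Removing an open neighbourhood of the exceptional null set, rather than the set itself, keeps [S]
   closed; [U] is small enough that [S] has positive measure. *)
have [|U [oU ZU Umu]] := haar_outer haar (e := mu (word_vcent w)) mZ; first by rewrite mZ0.
have mU := open_borel oU.
pose S := word_vcent w `\` U.
have cS : closed S by apply: closedI; [exact: word_vcent_closed|exact: open_closedC].
have mS' := closed_borel cS.
have Spos : 0 < mu S.
  rewrite lt0e measure_ge0 andbT; apply/eqP => S0.
  have : mu (word_vcent w) = mu S + mu (word_vcent w `&` U) := measureDI mu mS mU.
  rewrite S0 add0e => e.
  have : mu (word_vcent w `&` U) <= mu U.
    by apply: haar_le => //; exact: measurableI.
  by rewrite -e leNgt Umu.
have nsub g : S g -> forall m k, (m < k <= size w)%N -> (k - m < size w)%N ->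
    ~ vcent (eval_word (take (k - m) (drop m w)) g).
  move=> [_ nUg] m k /andP[mk kw] kmw vk; apply: nUg; apply: ZU.
  have mw : (m < (size w).+1)%N by lia.
  apply: (sZ0 (Ordinal mw, Ordinal (kw : (k < (size w).+1)%N))) => //.
  by rewrite mem_filter mem_enum /= mk kmw.
pose j0 : 'I_(size w) := Ordinal wsize.
pose i0 := (tnth (in_tuple w) j0).1.
pose P (j : 'I_(size w)) := (tnth (in_tuple w) j).1 == i0.
pose c (j : 'I_(size w)) : 'F_p := ((-1) ^+ (tnth (in_tuple w) j).2)%R.
have [|g Sg|V1 oV1 hV1] := @onormal_uniform G GR S
    (fun N g => ~ kills N P c (prefix_at g)).
- exact: subclosed_compact (@GR_compact G r) _.
- have [|||V oV hV] := @robust_distinct _ P c (prefix_at g) j0.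
  + move=> i j /eqP Pi /eqP Pj; apply: prefix_at_distinct => //.
    * by move=> y y0; apply/negP => ycan; apply: cycw; exists y.
    * exact: nsub.
    * by rewrite Pi Pj.
  + by move=> i _; rewrite /c expf_neq0// oppr_eq0 oner_eq0.
  + by rewrite /P /i0.
  exists V => //.
  have : \forall g' \near g, forall j : 'I_(size w), V ((prefix_at g j)^-1 * prefix_at g' j)%pg.
    apply: (@filter_forall _ _ (fun j => [set g' : GR |
      V ((prefix_at g j)^-1 * prefix_at g' j)%pg]) (nbhs g)) => j.
    apply: (@eval_word_continuous G r _ g [set y | V ((prefix_at g j)^-1 * y)%pg]).
    apply: open_nbhs_nbhs; split; first exact: coset_open.
    by rewrite /= pg_mulVg; exact: onormal1.
  by apply: filterS => g' Vg' N oN NV; apply: hV.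
(* For small [N], the cosets meeting [S] lie in [U2]. As [S] fills at most half of each, [U2] cannot
   have measure below twice that of [S]. *)
have [|U2 [oU2 SU2 U2mu]] := haar_outer haar (e := mu S + mu S) mS'.
  by rewrite -[ltLHS]adde0 lteD2lE// haar_fin.
have [V2 oV2 hV2] := GR_uniform_box cS oU2 SU2.
have [N3 oN3 N3H] := onormal_in_H.
pose N := V1 `&` (V2 `&` N3).
have oN : onormal N by do 2!apply: onormalI => //.
have [tv _] := onormal_transversal oN.
have mU2 := open_borel oU2.
suff : mu S + mu S <= mu U2 by rewrite leNgt U2mu.
apply: (@coset_index_double G r R mu N oN tv S U2 mS' mU2) => o.
have [[g [Sg <-]]|nS] := pselect (exists g, S g /\ coset_index tv g = o); last first.
  rewrite (_ : S `&` _ = set0) ?measure0 ?adde0 ?measure_ge0//.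
  by apply/seteqP; split=> // g [Sg go]; apply: nS; exists g.
have -> : U2 `&` [set h | coset_index tv h = coset_index tv g] =
    [set h | coset_index tv h = coset_index tv g].
  apply/setIidPr => h /= /esym/coset_indexP hg; apply: (hV2 N oN _ g Sg) => //.
  by move=> x [_ []].
apply: (@coset_half N tv S w i0 g oN _ cS _ Sg).
- by move=> x [_ [_ /N3H]].
- by move=> x [].
- by apply: (hV1 N oN) => // x [].
Qed.

End Measure.

End FreeProP.

Theorem theoremC (p : nat) (G : ProfGroup) :
  is_pro_p G p -> virtually_free_pro_p p G ->
  virtually_procyclic G \/ randomly_free G.
Proof.
move=> proG [H [[sH oH] [_ [X [iota [Hiota iota1 univ]]]]]].
have [[a [b ab]]|nab] := pselect (exists a b : X, a <> b); last first.
  left; exists H; split=> //.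
  have [[x0]|nX] := pselect (inhabited X).
    apply: (free_procyclic proG sH oH iota1 univ (Hiota x0)) => x.
    by congr iota; apply: contrapT => ?; apply: nab; exists x, x0.
  (* For empty [X] the condition on the generators is vacuous, so 1 serves as generator. *)
  apply: (free_procyclic proG sH oH iota1 univ (g := pg_one G)); first by case: sH.
  by move=> x; case: nX.
right=> r w [redw wN0 [R [mu [haar]]]]; apply/negP; rewrite -leNgt.
have null := word_vcent_null proG sH oH Hiota iota1 univ ab haar (leqnn (size w)) redw wN0.
(* Solutions of w = 1 lie in the null set where [w] takes values in K, since 1 is in K. *)
rewrite -null; apply: haar_le.
- apply: closed_borel.
  apply: (@closed_comp _ _ _ [set pg_one G]).
    by move=> z _; exact: eval_word_continuous.
  apply: accessible_closed_set1; apply: hausdorff_accessible; exact: pg_hausdorff.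
- by apply: closed_borel; exact: (word_vcent_closed proG sH oH Hiota iota1 univ ab).
- by move=> g /= e; rewrite /word_vcent /= e; exact: vcent1.
Qed.
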